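(* Let $2\le n<\infty$, let $\{e_i\}_{i\ge1}$ denote the standard basis of $\ell^2$, let $z\in\ell^2_1$, and let $\omega'_z$ be the geometric progression state of order $\infty$ on $\mathcal{O}_n$ by $z$. (i) Let $y=(y_1,\ldots,y_n)\in(\mathbb{C}^n)_1$ and let $\omega_y$ be the Cuntz state on $\mathcal{O}_n$ by $y$. Then $\omega'_z\sim\omega_y$ if and only if $|y_n|<1$ and $z=\tilde y$, where $\tilde y\in\ell^2_1$ is defined as $$\tilde y:=\sum_{r\ge0}\sum_{i=1}^{n-1}y_n^r\,y_i\,e_{(n-1)r+i}.$$ In this case, $\omega'_z=\omega_y$. (ii) Assume $m=(n-1)k+1$ and $k\ge2$. For $y=(y_1,\ldots,y_m)\in\mathcal{W}_m$, let $\omega'_y$ be the geometric progression state of order $k$ on $\mathcal{O}_n$ by $y$. Then $\omega'_z\sim\omega'_y$ if and only if $z=\tilde y$, where $\tilde y\in\ell^2_1$ is defined as $$\tilde y:=\sum_{r\ge0}\sum_{i=1}^{m-1}y_m^r\,y_i\,e_{(m-1)r+i}.$$ In this case, $\omega'_z=\omega'_y$.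
   Context: For $2\le n<\infty$, $\mathcal{O}_n$ denotes the Cuntz algebra: the universal unital C$^*$-algebra generated by $s_1,\ldots,s_n$ with $s_i^*s_j=\delta_{ij}I$ and $\sum_{i=1}^n s_is_i^*=I$. $(\mathbb{C}^m)_1$ is the set of unit vectors of $\mathbb{C}^m$, $\ell^2_1$ the set of unit vectors of $\ell^2=\ell^2(\{1,2,\ldots\})$, and $\mathcal{W}_m:=\{(w_1,\ldots,w_m)\in(\mathbb{C}^m)_1:|w_m|<1\}$. Convention: $s_n^0=I$, and $y_n^0=y_m^0=1$. Cuntz state: for $y\in(\mathbb{C}^n)_1$, $\omega_y$ is the unique (and pure) state on $\mathcal{O}_n$ with $\omega_y(s_j)=\overline{y_j}$ for $j=1,\ldots,n$. For $m=(n-1)k+1$ with $k\ge2$ and $y\in\mathcal{W}_m$, $\omega'_y$ denotes the geometric progression state of order $k$ by $y$: the unique (and pure) state on $\mathcal{O}_n$ with $\omega'_y(s_n^rs_i)=\overline{y_{(n-1)r+i}}$ for all $r=0,\ldots,k-1$, $i=1,\ldots,n-1$, and $\omega'_y(s_n^k)=\overline{y_m}$. For $z\in\ell^2_1$, $\omega'_z$ denotes the geometric progression state of order $\infty$ by $z$: the unique (and pure) state on $\mathcal{O}_n$ with $\omega'_z(s_n^rs_i)=\overline{z_{(n-1)r+i}}$ for all $r\ge 0$, $i=1,\ldots,n-1$. For states $\omega,\omega'$ on a C$^*$-algebra, $\omega\sim\omega'$ means that their GNS representations are unitarily equivalent. *)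

(* Defs.v *)
From HB Require Import structures.
From mathcomp Require Import all_boot all_order all_algebra.
From mathcomp Require Import complex.
From mathcomp Require Import boolp classical_sets functions reals.
From mathcomp Require Import topology normedtype sequences.

Set Implicit Arguments.
Unset Strict Implicit.
Unset Printing Implicit Defensive.

Import Order.TTheory GRing.Theory Num.Theory.
Import numFieldNormedType.Exports.

Local Open Scope classical_set_scope.
Local Open Scope ring_scope.

Section NormLimits.
Variables (C : numClosedFieldType) (V : zmodType) (N : V -> C).

Definition norm_cvg (u : nat -> V) (l : V) : Prop :=
  forall e : C, 0 < e -> exists p, forall q, (p <= q)%N -> N (u q - l) < e.

Definition norm_cauchy (u : nat -> V) : Prop :=
  forall e : C, 0 < e -> exists p, forall q q', (p <= q)%N -> (p <= q')%N ->
    N (u q - u q') < e.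

End NormLimits.

(* The norm is a field of the structure rather than an instance of
   completeNormedModType: Hierarchy Builder rejects a structure that inherits
   from both GRing.Algebra and NormedModule, since those meet only at
   numDomainType. As for the library's norms, its values are nonnegative
   elements of C, and its first three axioms are those of Lmodule_isNormed. *)
HB.mixin Record isCStarAlgebra (C : numClosedFieldType) A
    & GRing.Algebra C A := {
  cnorm : A -> C ;
  cnormD : forall x y : A, cnorm (x + y) <= cnorm x + cnorm y ;
  cnormZ : forall (c : C) (x : A), cnorm (c *: x) = `|c| * cnorm x ;
  cnorm0_eq0 : forall x : A, cnorm x = 0 -> x = 0 ;
  cnorm_complete : forall u : nat -> A, norm_cauchy cnorm u ->
    exists l, norm_cvg cnorm u l ;
  cnormM : forall x y : A, cnorm (x * y) <= cnorm x * cnorm y ;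
  star : A -> A ;
  starD : forall x y : A, star (x + y) = star x + star y ;
  starZ : forall (c : C) (x : A), star (c *: x) = c^* *: star x ;
  starM : forall x y : A, star (x * y) = star y * star x ;
  starK : involutive star ;
  cstar_identity : forall x : A, cnorm (star x * x) = cnorm x ^+ 2
}.

#[short(type="cstarAlgType")]
HB.structure Definition CStarAlgebra (C : numClosedFieldType) :=
  {A of isCStarAlgebra C A & GRing.Algebra C A}.

(* The inner product is linear in its first argument. *)
HB.mixin Record isHilbert (C : numClosedFieldType) H
    & CompleteNormedModule C H := {
  inner : {dot H for Num.conj} ;
  norm_inner : forall x : H, `|x| ^+ 2 = inner x x
}.

#[short(type="hilbertType")]
HB.structure Definition Hilbert (C : numClosedFieldType) :=
  {H of isHilbert C H & CompleteNormedModule C H}.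

(* The definitions are meant for C := R[i] with R : realType. *)
Section CStar.
Variable C : numClosedFieldType.
Implicit Types A B : cstarAlgType C.

Section CuntzAlgebra.
Variables (A : cstarAlgType C) (n : nat).

(* Tuples are numbered from 0: s`_i is s_{i+1}, and s`_n.-1 is s_n. *)
Definition cuntz_family B (s : n.-tuple B) : Prop :=
  (forall i j : 'I_n, star s`_i * s`_j = (i == j)%:R) /\
  \sum_(i < n) s`_i * star s`_i = 1.

Definition star_subalgebra (S : set A) : Prop :=
  [/\ S 1,
      forall (c : C) x y, S x -> S y -> S (c *: x + y),
      forall x y, S x -> S y -> S (x * y) &
      forall x, S x -> S (star x)].

Definition norm_closed (S : set A) : Prop :=
  forall (u : nat -> A) l, (forall q, S (u q)) -> norm_cvg cnorm u l -> S l.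

Definition cstar_generated (s : n.-tuple A) : Prop :=
  forall S : set A, norm_closed S -> star_subalgebra S ->
    (forall i : 'I_n, S s`_i) -> S = setT.

Definition cuntz_algebra (s : n.-tuple A) : Prop :=
  [/\ cuntz_family s,
      cstar_generated s &
      forall (B : cstarAlgType C) (t : n.-tuple B), cuntz_family t ->
        exists f : {lrmorphism A -> B},
          (forall a, f (star a) = star (f a)) /\
          (forall i : 'I_n, f s`_i = t`_i)].

End CuntzAlgebra.

Definition state A (omega : {scalar A}) : Prop :=
  (forall a, 0 <= omega (star a * a)) /\ omega 1 = 1.

Record star_representation A (H : hilbertType C) := StarRepresentation {
  rep :> A -> {linear H -> H} ;
  rep_continuous : forall a, continuous (rep a) ;
  rep_linear : forall (c : C) a b x,
    rep (c *: a + b) x = c *: rep a x + rep b x ;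
  rep1 : forall x, rep 1 x = x ;
  repM : forall a b x, rep (a * b) x = rep a (rep b x) ;
  rep_star : forall a x y, inner (rep a x) y = inner x (rep (star a) y)
}.

(* pi with the cyclic vector Omega is a GNS representation of omega; such a
   triple (H, pi, Omega) is unique up to unitary equivalence. *)
Definition gns_triple A (omega : {scalar A}) (H : hilbertType C)
    (pi : star_representation A H) (Omega : H) : Prop :=
  (forall a, omega a = inner (pi a Omega) Omega) /\
  dense (range (fun a => pi a Omega)).

Definition unitarily_equivalent A (H1 H2 : hilbertType C)
    (pi1 : star_representation A H1) (pi2 : star_representation A H2) : Prop :=
  exists U : {linear H1 -> H2},
    [/\ bijective U,
        forall x y, inner (U x) (U y) = inner x y &
        forall a x, U (pi1 a x) = pi2 a (U x)].

Definition equivalent_states A (omega1 omega2 : {scalar A}) : Prop :=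
  exists (H1 H2 : hilbertType C)
    (pi1 : star_representation A H1) (pi2 : star_representation A H2)
    (Omega1 : H1) (Omega2 : H2),
    [/\ gns_triple omega1 pi1 Omega1,
        gns_triple omega2 pi2 Omega2 &
        unitarily_equivalent pi1 pi2].

Definition unit_vector m (y : m.-tuple C) : Prop :=
  \sum_(i < m) `|y`_i| ^+ 2 = 1.

(* An element z of l^2({1, 2, ...}) is given by its coordinates, z j being
   z_{j+1}. *)
Definition ell2_unit (z : nat -> C) : Prop :=
  series (fun j => `|z j| ^+ 2) @ \oo --> (1 : C).

Definition cuntz_state A n (s : n.-tuple A) (y : n.-tuple C)
    (omega : {scalar A}) : Prop :=
  state omega /\ forall j : 'I_n, omega s`_j = (y`_j)^*.

Definition gp_state A n (s : n.-tuple A) k m (y : m.-tuple C)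
    (omega : {scalar A}) : Prop :=
  [/\ state omega,
      forall r i, (r < k)%N -> (i < n.-1)%N ->
        omega (s`_n.-1 ^+ r * s`_i) = (y`_(n.-1 * r + i))^* &
      omega (s`_n.-1 ^+ k) = (y`_m.-1)^*].

Definition gp_state_infty A n (s : n.-tuple A) (z : nat -> C)
    (omega : {scalar A}) : Prop :=
  state omega /\
  forall r i, (i < n.-1)%N ->
    omega (s`_n.-1 ^+ r * s`_i) = (z (n.-1 * r + i)%N)^*.

Definition ell2_basis (k : nat) : nat -> C := fun j => (j == k)%:R.

(* The series defining the sequence y~, read coordinatewise; on each coordinate
   it has at most one nonzero term (see geometric_seqE). *)
Definition geometric_seq m (y : m.-tuple C) : nat -> C := fun j =>
  limn (series (fun r => \sum_(i < m.-1)
    y`_m.-1 ^+ r * y`_i * ell2_basis (m.-1 * r + i) j)).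

Lemma geometric_seqE m (y : m.-tuple C) r i : (i < m.-1)%N ->
  geometric_seq y (m.-1 * r + i) = y`_m.-1 ^+ r * y`_i.
Proof.
move=> im; rewrite /geometric_seq.
have m0 : (0 < m.-1)%N by apply: leq_ltn_trans im.
pose F q := \sum_(j < m.-1)
  y`_m.-1 ^+ q * y`_j * ell2_basis (m.-1 * q + j) (m.-1 * r + i).
have F0 q : q != r -> F q = 0.
  move=> qr; rewrite /F big1// => j _; rewrite /ell2_basis.
  case: eqP => [/(congr1 (divn^~ m.-1))|_]; last by rewrite mulr0.
  rewrite ![(m.-1 * _)%N]mulnC !divnMDl// !divn_small// !addn0 => rq.
  by rewrite rq eqxx in qr.
have Fr : F r = y`_m.-1 ^+ r * y`_i.
  rewrite /F (bigD1 (Ordinal im))//= /ell2_basis eqxx mulr1 big1 ?addr0// => j.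
  rewrite eqn_add2l eq_sym => /eqP ji.
  case: eqP => [e|_]; last by rewrite mulr0.
  by case: ji; apply: val_inj.
rewrite -Fr; apply: cvg_lim; first exact: norm_hausdorff.
apply: cvg_near_cst; near=> N; rewrite /series/=.
have rN : (r < N)%N by near: N; exact: nbhs_infty_gt.
rewrite big_mkord (bigD1 (Ordinal rN))//= -/(F r) big1 ?addr0// => j jr.
rewrite -/(F j); apply: F0; apply: contra jr => /eqP e.
by apply/eqP/val_inj.
Unshelve. all: by end_near. Qed.

End CStar.

(* Main.v *)
Require Import Defs.
From HB Require Import structures.
From mathcomp Require Import all_boot all_order all_algebra.
From mathcomp Require Import complex boolp classical_sets functions reals.
From mathcomp Require Import interval_inference topology normedtype sequences.
From mathcomp Require Import ring.

(** Put t_j = s_n^r s_i for j = (n-1)r + i. In the GNS space of either kind of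
    state the cyclic vector Omega satisfies t_j^* Omega = z_j Omega, by the
    equality case of Bessel's inequality (with z replaced by y~ for the states
    of finite order). Let tau_M = sum_(j < M) z_j t_j, so that
    tau_M^* tau_M = p_M = sum_(j < M) |z_j|^2, which tends to 1.

    The vectors of level L, those which all products of L operators t_j^* map
    to multiples of Omega, exhaust a dense subspace, because the generators and
    their adjoints raise the level by at most one.

    Uniqueness: tau_M Omega is close to Omega, so that omega a is close to the
    scalar by which (tau_M^* )^L a acts on Omega, and this scalar is the same
    for two states with the same parameter z.

    Inequivalence: let Omega_1, Omega_2 be vectors with parameters z and w in
    one representation, Omega_2 cyclic. Then tau_M^* is a contraction that
    multiplies Omega_1 by p_M and Omega_2 by lambda_M = sum_(j < M) z_j^* w_j,
    and its L-th power maps an approximant of Omega_1 of level L to the line of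
    Omega_2. Comparing the L-th and (L+1)-st powers gives lambda_M - p_M -> 0,
    hence sum_(j < M) |z_j - w_j|^2 -> 0. *)

Set Implicit Arguments.
Unset Strict Implicit.
Unset Printing Implicit Defensive.

Import Order.TTheory GRing.Theory Num.Theory.
Import numFieldNormedType.Exports.

Local Open Scope ring_scope.

(** * Semi-inner products *)

Section SemiInnerProducts.
Variables (C : numClosedFieldType) (V : lmodType C).

Record semi_inner := SemiInner {
  sip :> V -> V -> C ;
  sip_linear : forall c x y z, sip (c *: x + y) z = c * sip x z + sip y z ;
  sipC : forall x y, sip x y = (sip y x)^* ;
  sip_ge0 : forall x, 0 <= sip x x
}.

Section Theory.
Variable f : semi_inner.

Lemma sipDl x y z : f (x + y) z = f x z + f y z.
Proof. by have := sip_linear f 1 x y z; rewrite scale1r mul1r. Qed.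

Lemma sip0l z : f 0 z = 0.
Proof. by apply: (@addrI _ (f 0 z)); rewrite -sipDl !addr0. Qed.

Lemma sipZl c x z : f (c *: x) z = c * f x z.
Proof. by have := sip_linear f c x 0 z; rewrite sip0l !addr0. Qed.

Lemma sipNl x z : f (- x) z = - f x z.
Proof. by rewrite -scaleN1r sipZl mulN1r. Qed.

Lemma sipBl x y z : f (x - y) z = f x z - f y z.
Proof. by rewrite sipDl sipNl. Qed.

Lemma sipDr x y z : f z (x + y) = f z x + f z y.
Proof. by rewrite sipC sipDl rmorphD /= -!sipC. Qed.

Lemma sipZr c x z : f z (c *: x) = c^* * f z x.
Proof. by rewrite sipC sipZl rmorphM /= -sipC. Qed.

Lemma sipNr x z : f z (- x) = - f z x.
Proof. by rewrite sipC sipNl rmorphN /= -sipC. Qed.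

Lemma sipBr x y z : f z (x - y) = f z x - f z y.
Proof. by rewrite sipDr sipNr. Qed.

Lemma sip_sqr_axpy c x y :
  f (x - c *: y) (x - c *: y) =
  f x x - c^* * f x y - c * (f x y)^* + `|c| ^+ 2 * f y y.
Proof.
by rewrite sipBl !sipBr !sipZl !sipZr (sipC f y x) normCK; ring.
Qed.

Lemma sip_CauchySchwarz x y : `|f x y| ^+ 2 <= f x x * f y y.
Proof.
have fyr := ger0_real (sip_ge0 f y).
have [fy0|fyN0] := eqVneq (f y y) 0; last first.
  have fyp : 0 < f y y by rewrite lt0r fyN0 sip_ge0.
  have := sip_ge0 f (x - (f x y / f y y) *: y).
  rewrite sip_sqr_axpy rmorphM /= fmorphV /= (CrealP fyr).
  rewrite normrM normfV (ger0_norm (sip_ge0 f y)) exprMn.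
  rewrite -(pmulr_rge0 _ fyp) normCK.
  suff -> : f y y * (f x x - (f x y)^* / f y y * f x y -
      f x y / f y y * (f x y)^* +
      f x y * (f x y)^* * (f y y)^-1 ^+ 2 * f y y) =
      f x x * f y y - f x y * (f x y)^* by rewrite subr_ge0.
  by field.
rewrite fy0 mulr0.
have [->|fxyN0] := eqVneq (f x y) 0; first by rewrite normr0 expr0n.
exfalso; pose p := `|f x y| ^+ 2.
have pp : 0 < p by rewrite exprn_gt0 // normr_gt0.
(* The form need not be definite, so a null [y] is treated apart. This [r] solves
   [f x x - 2 r p = -1], so that the form would take the value -1 at [x - r (f x y) y]. *)
pose r := (f x x + 1) / (2 * p).
have rr : r^* = r.
  apply/CrealP/ger0_real.
  by rewrite divr_ge0 ?addr_ge0 ?sip_ge0 // mulr_ge0 // ltW.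
have := sip_ge0 f (x - (r * f x y) *: y).
rewrite sip_sqr_axpy fy0 mulr0 addr0 rmorphM /= rr.
have -> : f x x - r * (f x y)^* * f x y - r * f x y * (f x y)^* = - 1.
  have -> : f x x - r * (f x y)^* * f x y - r * f x y * (f x y)^* =
      f x x - 2 * r * p by rewrite /p normCK; ring.
  by rewrite /r; field; rewrite gt_eqF.
by rewrite oppr_ge0 ler10.
Qed.

Definition snorm x : C := sqrtC (f x x).

Lemma snorm_ge0 x : 0 <= snorm x.
Proof. by rewrite sqrtC_ge0 sip_ge0. Qed.
Hint Resolve snorm_ge0 : core.

Lemma snorm_sqr x : snorm x ^+ 2 = f x x.
Proof. exact: sqrtCK. Qed.

Lemma le_sip_snorm x y : `|f x y| <= snorm x * snorm y.
Proof.
rewrite -ler_sqr ?nnegrE ?mulr_ge0 // exprMn !snorm_sqr.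
exact: sip_CauchySchwarz.
Qed.

Lemma snormZ c x : snorm (c *: x) = `|c| * snorm x.
Proof.
rewrite /snorm sipZl sipZr mulrA -normCK sqrtCM ?nnegrE ?sip_ge0 ?exprn_ge0 //.
by rewrite sqrCK.
Qed.

Lemma snorm0 : snorm 0 = 0.
Proof. by rewrite /snorm sip0l sqrtC0. Qed.

Lemma snormD x y : snorm (x + y) <= snorm x + snorm y.
Proof.
rewrite -ler_sqr ?nnegrE ?addr_ge0 // sqrrD !snorm_sqr sipDl !sipDr.
rewrite (sipC f y x) addrA -(addrA (f x x)) lerD2r lerD2l.
have -> : f x y + (f x y)^* = 'Re (f x y) *+ 2.
  by rewrite ReE -mulr_natr divfK // pnatr_eq0.
rewrite lerMn2r /=; apply: le_trans (le_sip_snorm x y).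
by rewrite (le_trans (real_ler_norm (Creal_Re _))) // leif_normC_Re_Creal.
Qed.

Lemma snorm_eq0 x : (snorm x == 0) = (f x x == 0).
Proof. exact: sqrtC_eq0. Qed.

Lemma sip_eq0l x y : f x x = 0 -> f x y = 0.
Proof.
move=> fx0; apply/eqP; rewrite -normr_le0.
apply: le_trans (le_sip_snorm x y) _.
by rewrite /snorm fx0 sqrtC0 mul0r.
Qed.

Lemma sip_null_linear c x y :
  f x x = 0 -> f y y = 0 -> f (c *: x + y) (c *: x + y) = 0.
Proof.
by move=> fx fy; rewrite sip_linear (sip_eq0l _ fx) (sip_eq0l _ fy) mulr0 addr0.
Qed.

End Theory.
End SemiInnerProducts.

#[global] Hint Extern 0 (is_true (@Order.le _ _ _ (@snorm _ _ _ _))) =>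
  solve [apply: snorm_ge0] : core.

(** * C*-algebras and positive functionals *)

(** A [numClosedFieldType] need not be Archimedean. This is the form of that property which
    geometric convergence uses; [complex_halving] supplies it for [R[i]]. *)
Definition halving (C : numClosedFieldType) :=
  forall e : C, 0 < e -> exists k, 2^-1 ^+ k < e.

Section CStarAlgebras.
Variables (C : numClosedFieldType) (A : cstarAlgType C).
Implicit Types a b c h x : A.

Lemma star0 : star (0 : A) = 0.
Proof. by have := starZ 0 (0 : A); rewrite !scale0r conjC0 scale0r. Qed.

Lemma star1 : star (1 : A) = 1.
Proof. by have := starM (star (1 : A)) 1; rewrite mulr1 starK mulr1. Qed.

Lemma starN a : star (- a) = - star a.
Proof. by rewrite -scaleN1r starZ rmorphN1 scaleN1r. Qed.

Lemma starB a b : star (a - b) = star a - star b.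
Proof. by rewrite starD starN. Qed.

Lemma star_sum I (r : seq I) (P : pred I) (F : I -> A) :
  star (\sum_(i <- r | P i) F i) = \sum_(i <- r | P i) star (F i).
Proof. exact: (big_morph star (@starD _ _) star0). Qed.

Lemma starX a k : star (a ^+ k) = star a ^+ k.
Proof. by elim: k => [|k IH]; rewrite ?star1 // exprS starM IH exprSr. Qed.

Lemma cnorm0 : cnorm (0 : A) = 0.
Proof. by rewrite -(scale0r (0 : A)) cnormZ normr0 mul0r. Qed.

Lemma cnormN a : cnorm (- a) = cnorm a.
Proof. by rewrite -scaleN1r cnormZ normrN1 mul1r. Qed.

Lemma cnorm_ge0 a : 0 <= cnorm a.
Proof.
have := cnormD a (- a); rewrite subrr cnorm0 cnormN -mulr2n.
by rewrite pmulrn_lge0.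
Qed.
Hint Resolve cnorm_ge0 : core.

Lemma cnorm_distrC a b : cnorm (a - b) = cnorm (b - a).
Proof. by rewrite -cnormN opprB. Qed.

Lemma cnorm_star a : cnorm (star a) = cnorm a.
Proof.
have le x : cnorm x <= cnorm (star x).
  have [->|x0] := eqVneq (cnorm x) 0; first exact: cnorm_ge0.
  rewrite -(ler_pM2r (_ : 0 < cnorm x)) ?lt0r ?x0 //=.
  by rewrite -expr2 -cstar_identity cnormM.
by apply/le_anti; rewrite le andbT -{2}(starK a) le.
Qed.

Lemma cnormB_trans b a c : cnorm (a - c) <= cnorm (a - b) + cnorm (b - c).
Proof. by apply: le_trans (cnormD _ _); rewrite addrA subrK. Qed.

Lemma cnorm_cvg_unique (u : nat -> A) l l' :
  norm_cvg cnorm u l -> norm_cvg cnorm u l' -> l = l'.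
Proof.
move=> ul ul'; apply/eqP; rewrite -subr_eq0; apply/eqP/cnorm0_eq0/eqP.
apply/negPn/negP => n0.
have e0 : 0 < cnorm (l - l') / 2 by rewrite divr_gt0 // lt0r n0 cnorm_ge0.
have [p pP] := ul _ e0; have [q qP] := ul' _ e0.
have := ltrD (pP (maxn p q) (leq_maxl _ _)) (qP (maxn p q) (leq_maxr _ _)).
rewrite -splitr cnorm_distrC => /(le_lt_trans (cnormB_trans _ _ _)).
by rewrite ltxx.
Qed.

(* For self-adjoint [h] with [cnorm h <= 1/2], the map [c |-> (h + c^2)/2] is a
   contraction of the ball of radius 1/2; its fixed point satisfies
   [(1 - c)^2 = 1 - h]. *)
Lemma cstar_sqrt1B h : halving C ->
  star h = h -> cnorm h <= 2^-1 -> exists d, 1 - h = star d * d.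
Proof.
move=> half_small hh h2; pose g c := 2^-1 *: (h + c * c).
pose u k := iter k g 0.
have half0 : 0 <= 2^-1 :> C by rewrite invr_ge0.
have halfn : `|2^-1| = 2^-1 :> C by rewrite ger0_norm.
have u2 k : cnorm (u k) <= 2^-1.
  elim: k => [|k IH]; first by rewrite cnorm0.
  rewrite /= cnormZ halfn -[leRHS]mulr1 ler_pM2l ?invr_gt0 //.
  apply: le_trans (cnormD _ _) _; rewrite [leRHS]splitr mul1r lerD //.
  apply: le_trans (cnormM _ _) _; rewrite -[leRHS]mulr1 ler_pM //.
  by apply: le_trans IH _; rewrite invf_le1 // ler1n.
have g_contr c c' : cnorm c <= 2^-1 -> cnorm c' <= 2^-1 ->
    cnorm (g c - g c') <= 2^-1 * cnorm (c - c').
  move=> c2 c2'; rewrite -scalerBr cnormZ halfn ler_pM2l ?invr_gt0 //.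
  have -> : h + c * c - (h + c' * c') = c * (c - c') + (c - c') * c'.
    by rewrite mulrBr mulrBl opprD addrACA subrr add0r addrA subrK.
  apply: le_trans (cnormD _ _) _; rewrite [leRHS]splitr.
  apply: lerD; apply: le_trans (cnormM _ _) _; last by rewrite ler_wpM2l.
  by rewrite mulrC ler_wpM2l.
(* The two terms are the [k]-fold images under [g] of [u q] and of 0. *)
have ustep k q : cnorm (u (k + q)%N - u k) <= 2^-1 ^+ k * cnorm (u q).
  elim: k => [|k IH]; first by rewrite add0n mul1r subr0.
  rewrite addSn /= exprS -mulrA; apply: le_trans (g_contr _ _ (u2 _) (u2 _)) _.
  by rewrite ler_pM2l ?invr_gt0.
have ucauchy : norm_cauchy cnorm u.
  move=> e e0; have [k kP] := half_small _ e0; exists k => q q' kq kq'.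
  apply: le_lt_trans (cnormB_trans (u k) _ _) _.
  rewrite (cnorm_distrC (u k)); apply: le_lt_trans kP.
  rewrite -(subnKC kq) -(subnKC kq') [leRHS]splitr.
  apply: lerD; apply: le_trans (ustep _ _) _;
    by rewrite ler_wpM2l // exprn_ge0.
have [c uc] := cnorm_complete u ucauchy.
have c2 : cnorm c <= 2^-1.
  apply/ler_addgt0Pr => e e0; have [p /(_ p (leqnn p)) pP] := uc _ e0.
  rewrite -(subrK (u p) c); apply: le_trans (cnormD _ _) _.
  by rewrite addrC lerD // cnorm_distrC ltW.
have fixc : g c = c.
  apply: (@cnorm_cvg_unique (fun k => u k.+1)) => e /uc[p pP]; exists p => q pq.
    apply: le_lt_trans (g_contr _ _ (u2 _) c2) _.
    apply: le_lt_trans (pP q pq); rewrite ler_piMl //.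
    by rewrite invf_le1 // ler1n.
  by apply: pP; exact: leq_trans (leqnSn _).
have starc : star c = c.
  have us k : star (u k) = u k.
    elim: k => [|k IH]; first exact: star0.
    rewrite /= starZ starD hh starM IH; congr (_ *: _).
    by apply/CrealP; rewrite realV realn.
  apply: (@cnorm_cvg_unique u) => // e /uc[p pP]; exists p => q pq.
  by rewrite -(us q) -starB cnorm_star pP.
exists (1 - c); rewrite starB star1 starc.
have cc : c * c = 2 *: c - h.
  by rewrite -{3}fixc scalerA divff ?pnatr_eq0 // scale1r addrC addKr.
rewrite mulrBr mulr1 mulrBl mul1r cc scaler_nat mulr2n.
by rewrite !opprD !opprK !addrA subrK addrC !addrA addrNK addrC.
Qed.

End CStarAlgebras.

#[global] Hint Extern 0 (is_true (@Order.le _ _ _ (@cnorm _ _ _))) =>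
  solve [apply: cnorm_ge0] : core.

(* [linearZ] would also rewrite products of scalars, read as scalings. *)
Lemma scalar_linearZ (R : pzRingType) (U : lmodType R) (f : {scalar U}) c x :
  f (c *: x) = c * f x.
Proof. exact: linearZ_LR. Qed.

(** * The semi-inner product of a positive functional *)

Section PositiveFunctionals.
Variables (C : numClosedFieldType) (A : cstarAlgType C).
Variables (omega : {scalar A}) (omega_ge0 : forall a, 0 <= omega (star a * a)).

Implicit Types a x y : A.

Let gns_linear (c : C) (x y z : A) : omega (star z * (c *: x + y)) =
  c * omega (star z * x) + omega (star z * y).
Proof. by rewrite mulrDr -scalerAr linearP. Qed.

(** Polarization: [omega] is real on [star b * b] for [b = x + c y]. The choices [c = 1] and
    [c = 'i] show that the sum of the two values, and ['i] times their difference, are real. *)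
Let gns_herm (x y : A) : omega (star y * x) = (omega (star x * y))^*.
Proof.
have sq (c : C) : omega (star (x + c *: y) * (x + c *: y)) =
    omega (star x * x) + `|c| ^+ 2 * omega (star y * y)
    + (c * omega (star x * y) + c^* * omega (star y * x)).
  rewrite normCK; set rhs := RHS; rewrite starD starZ mulrDl !mulrDr.
  rewrite -!scalerAr -!scalerAl !linearD !(scalar_linearZ omega) /=.
  by rewrite /rhs; ring.
have re (c : C) :
    c * omega (star x * y) + c^* * omega (star y * x) \is Num.real.
  have := ger0_real (omega_ge0 (x + c *: y)); rewrite sq rpredDl //.
  by rewrite rpredD ?rpredM ?ger0_real ?exprn_ge0.
have /CrealP := re 1; have /CrealP := re 'i.
rewrite !rmorphD !rmorphM /= !conjCK !conjCi conjC1 !mul1r.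
set v := omega (star x * y); set w := omega (star y * x) => e1 e2.
have e1' : - v^* + w^* = v - w.
  apply: (mulfI (neq0Ci C)).
  by rewrite mulrDr mulrBr !mulrN -mulNr -mulNr e1.
apply: (mulfI (_ : 2 != 0)); first by rewrite pnatr_eq0.
have -> : 2 * w = (v + w) - (v - w) by ring.
by rewrite -e1' -e2; ring.
Qed.

Definition gns_form : semi_inner A :=
  SemiInner gns_linear gns_herm omega_ge0.

Lemma gns_formE x y : gns_form x y = omega (star y * x).
Proof. by []. Qed.

Lemma state_star a : omega (star a) = (omega a)^*.
Proof. by have := gns_herm 1 a; rewrite star1 mulr1 mul1r. Qed.

Lemma gns_form_adjoint a x y : gns_form (a * x) y = gns_form x (star a * y).
Proof. by rewrite !gns_formE starM starK mulrA. Qed.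

Lemma gns_form_null_left_ideal a x :
  gns_form x x = 0 -> gns_form (a * x) (a * x) = 0.
Proof. by move=> x0; rewrite gns_form_adjoint sip_eq0l. Qed.

(** With [K = 2 |a|^2] the element [h = K^-1 (star a * a)] has norm at most 1/2, the radius allowed
    in [cstar_sqrt1B]. Writing [1 - h = star d * d], the difference of the two sides is [K] times
    the form at [d * x]. The factor 2 is harmless, since only continuity of the action is at
    stake. *)
Lemma gns_form_bounded (half_small : halving C) a x :
  gns_form (a * x) (a * x) <= 2 * cnorm a ^+ 2 * gns_form x x.
Proof.
have [a0|a0] := eqVneq (cnorm a) 0.
  by rewrite (cnorm0_eq0 _ a0) mul0r sip0l cnorm0 expr0n mulr0 mul0r.
pose K : C := 2 * cnorm a ^+ 2.
have K0 : 0 < K by rewrite mulr_gt0 // exprn_gt0 // lt0r a0 cnorm_ge0.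
have Kn : `|K^-1| = K^-1 by rewrite ger0_norm // invr_ge0 ltW.
have [|| d dP] := @cstar_sqrt1B _ _ (K^-1 *: (star a * a)) half_small.
- rewrite starZ starM starK; congr (_ *: _).
  by apply/CrealP; rewrite realV gtr0_real.
- rewrite cnormZ cstar_identity Kn mulrC ler_pdivrMr //.
  by rewrite /K mulKf ?pnatr_eq0.
rewrite -/K -subr_ge0.
have -> : K * gns_form x x - gns_form (a * x) (a * x) =
    K * gns_form (d * x) (d * x).
  have -> : gns_form (d * x) (d * x) =
      gns_form x x - K^-1 * gns_form (a * x) (a * x).
    rewrite !gns_formE !starM mulrA -(mulrA (star x)) -dP mulrBr mulr1 mulrBl.
    by rewrite linearB -scalerAr -scalerAl (scalar_linearZ omega) /= !mulrA.
  by rewrite mulrBr mulrA divff ?gt_eqF // mul1r.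
by rewrite mulr_ge0 ?sip_ge0 // ltW.
Qed.

Lemma gns_snormM (half_small : halving C) a x :
  snorm gns_form (a * x) <= 2 * cnorm a * snorm gns_form x.
Proof.
have K0 : 0 <= 2 * cnorm a by rewrite mulr_ge0.
rewrite -ler_sqr ?nnegrE ?mulr_ge0 // !exprMn !snorm_sqr.
apply: le_trans (gns_form_bounded half_small a x) _.
by rewrite !ler_wpM2r ?sip_ge0 ?exprn_ge0 // -natrX ler_nat.
Qed.

End PositiveFunctionals.

(** * Hilbert completion *)

Section ClosedFieldLimits.
Local Open Scope classical_set_scope.
Variable C : numClosedFieldType.
Implicit Types (u v : nat -> C) (l m : C).

Lemma cvgn_unique u l m : u @ \oo --> l -> u @ \oo --> m -> l = m.
Proof. by move=> ul um; exact: (cvg_unique (@norm_hausdorff C C) ul um). Qed.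

Lemma cvgn_lt u l : u @ \oo --> l ->
  forall e : C, 0 < e -> exists p, forall k, (p <= k)%N -> `|u k - l| < e.
Proof.
move=> /cvgrPdistC_lt ul e /ul[p _ pP]; exists p => k pk; exact: pP.
Qed.

Lemma lt_cvgn u l :
  (forall e : C, 0 < e -> exists p, forall k, (p <= k)%N -> `|u k - l| < e) ->
  u @ \oo --> l.
Proof.
by move=> ul; apply/cvgrPdistC_lt => e /ul[p pP]; exists p.
Qed.

Lemma cvgn_conj u l : u @ \oo --> l -> (u k)^* @[k --> \oo] --> l^*.
Proof.
move=> /cvgn_lt ul; apply: lt_cvgn => e /ul[p pP]; exists p => k pk.
by rewrite -rmorphB norm_conjC pP.
Qed.

(** The order of [C] is partial, so the sign of the limit is read off from continuity of the norm: a
    nonnegative sequence equals its sequence of norms. *)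
Lemma cvgn_ge0 u l : u @ \oo --> l -> (forall k, 0 <= u k) -> 0 <= l.
Proof.
move=> ul u0; suff -> : l = `|l| by rewrite normr_ge0.
have un : `|u k| @[k --> \oo] --> `|l| by exact: cvg_norm.
apply: cvgn_unique ul _; rewrite (_ : u = fun k => `|u k|) //.
by apply/funext => k; rewrite ger0_norm.
Qed.

Lemma cvgn_le u v l m : u @ \oo --> l -> v @ \oo --> m ->
  (exists p, forall k, (p <= k)%N -> u k <= v k) -> l <= m.
Proof.
move=> ul vm [p uv]; rewrite -subr_ge0.
apply: (@cvgn_ge0 (fun k => v (k + p)%N - u (k + p)%N)) => [|k].
  have vu : v \- u @ \oo --> m - l by exact: cvgB.
  by move: vu; rewrite -(cvg_shiftn p).
by rewrite subr_ge0 uv // leq_addl.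
Qed.

End ClosedFieldLimits.

Definition cauchy_complete (C : numClosedFieldType) :=
  forall u : nat -> C, norm_cauchy Num.norm u -> cvgn u.

(* A Cauchy sequence [u] is encoded by the functional [b |-> lim f (u k) b];
   sequences at distance tending to 0 give the same functional, so that no
   quotient is needed. *)
Section Completion.
Local Open Scope classical_set_scope.
Variables (C : numClosedFieldType) (V : lmodType C) (f : semi_inner V).
Implicit Types (u v w : nat -> V) (g : V -> C).

Definition represents u g := forall b, f (u k) b @[k --> \oo] --> g b.

Definition scauchy u := norm_cauchy (snorm f) u.

Lemma scauchy_cst a : scauchy (fun=> a).
Proof. by move=> e e0; exists 0%N => q q' _ _; rewrite subrr snorm0. Qed.

Lemma scauchy_linear c u v :
  scauchy u -> scauchy v -> scauchy (fun k => c *: u k + v k).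
Proof.
move=> cu cv e e0.
have c0 : 0 < `|c| + 1 by rewrite ltr_wpDl.
have [p pP] := cu (e / 2 / (`|c| + 1)) (divr_gt0 (divr_gt0 e0 (ltr0Sn _ 1)) c0).
have [q qP] := cv (e / 2) (divr_gt0 e0 (ltr0Sn _ 1)).
exists (maxn p q) => k k'; rewrite !geq_max => /andP[pk qk] /andP[pk' qk'].
have -> : c *: u k + v k - (c *: u k' + v k') =
    c *: (u k - u k') + (v k - v k') by rewrite scalerBr opprD addrACA.
apply: le_lt_trans (snormD _ _ _) _; rewrite snormZ [ltRHS]splitr.
apply: ler_ltD; last exact: qP.
apply: le_trans (_ : (`|c| + 1) * snorm f (u k - u k') <= _).
  by rewrite ler_wpM2r // lerDl.
by rewrite mulrC -ler_pdivlMr // ltW // pP.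
Qed.

Lemma scauchy_bounded u : scauchy u ->
  exists2 B : C, 0 < B & exists p, forall k, (p <= k)%N -> snorm f (u k) <= B.
Proof.
move=> /(_ 1 ltr01)[p pP]; exists (snorm f (u p) + 1).
  by rewrite ltr_wpDl.
exists p => k pk; rewrite -[u k](subrK (u p)) addrC.
apply: le_trans (snormD _ _ _) _.
by rewrite lerD2l ltW // pP.
Qed.

Lemma scauchy_sip u v : scauchy u -> scauchy v ->
  norm_cauchy Num.norm (fun k => f (u k) (v k)).
Proof.
move=> cu cv e e0.
have [B B0 [p pB]] := scauchy_bounded cu.
have [B' B'0 [p' pB']] := scauchy_bounded cv.
have [q qP] := cu (e / 2 / B') (divr_gt0 (divr_gt0 e0 (ltr0Sn _ 1)) B'0).
have [q' qP'] := cv (e / 2 / B) (divr_gt0 (divr_gt0 e0 (ltr0Sn _ 1)) B0).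
exists (maxn (maxn p p') (maxn q q')) => k k'.
rewrite !geq_max => /andP[/andP[? ?] /andP[? ?]] /andP[/andP[? ?] /andP[? ?]].
have -> : f (u k) (v k) - f (u k') (v k') =
  f (u k - u k') (v k) + f (u k') (v k - v k').
  by rewrite sipBl sipBr addrA subrK.
apply: le_lt_trans (ler_normD _ _) _; rewrite [ltRHS]splitr.
apply: ltrD.
  apply: le_lt_trans (le_sip_snorm _ _ _) _.
  apply: le_lt_trans (_ : snorm f (u k - u k') * B' < _).
    by rewrite ler_wpM2l // pB'.
  by rewrite -ltr_pdivlMr // qP.
apply: le_lt_trans (le_sip_snorm _ _ _) _.
apply: le_lt_trans (_ : B * snorm f (v k - v k') < _).
  by rewrite ler_wpM2r // pB.
by rewrite mulrC -ltr_pdivlMr // qP'.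
Qed.

(** Since [w] is bounded, [v k] may be replaced by a fixed [v q] at small cost, and against a fixed
    vector [w] tends to 0. This is what makes the inner product independent of representatives. *)
Lemma represents0_sip w v : scauchy w -> scauchy v -> represents w (fun=> 0) ->
  f (w k) (v k) @[k --> \oo] --> (0 : C).
Proof.
move=> cw cv w0; apply: lt_cvgn => e e0.
have [B B0 [p pB]] := scauchy_bounded cw.
have [q qP] := cv (e / 2 / B) (divr_gt0 (divr_gt0 e0 (ltr0Sn _ 1)) B0).
have [q' qP'] := cvgn_lt (w0 (v q)) (divr_gt0 e0 (ltr0Sn _ 1)).
exists (maxn p (maxn q q')) => k; rewrite !geq_max => /and3P[pk qk qk'].
rewrite subr0 -[v k](subrK (v q)) sipDr.
apply: le_lt_trans (ler_normD _ _) _; rewrite [ltRHS]splitr ltrD //.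
  apply: le_lt_trans (le_sip_snorm _ _ _) _.
  apply: le_lt_trans (_ : B * snorm f (v k - v q) < _).
    by rewrite ler_wpM2r // pB.
  by rewrite mulrC -ltr_pdivlMr // qP.
by have := qP' _ qk'; rewrite subr0.
Qed.

Lemma represents_linear c u v g h : represents u g -> represents v h ->
  represents (fun k => c *: u k + v k) (c *: g + h).
Proof.
move=> ug vh b; under eq_fun do rewrite sip_linear.
by apply: (cvgD (f := fun k => c * f (u k) b)) (vh b); exact: cvgMl_tmp (ug b).
Qed.

Definition represented : {pred V -> C} :=
  fun g => `[< exists2 u, scauchy u & represents u g >].

Lemma represented_submod : submod_closed represented.
Proof.
split=> [|c g h /asboolP[u cu ug] /asboolP[v cv vh]]; apply/asboolP.
  exists (fun=> 0); first exact: scauchy_cst.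
  by move=> b; under eq_fun do rewrite sip0l; exact: cvg_cst.
by exists (fun k => c *: u k + v k);
  [exact: scauchy_linear | exact: represents_linear].
Qed.

HB.instance Definition _ :=
  GRing.isSubmodClosed.Build C (V -> C) represented represented_submod.

End Completion.

(** The two hypotheses on [C] are parameters of the type, so that instances whose proofs rely on
    them can be attached to it. *)
Record completion (C : numClosedFieldType) (half_small : halving C)
    (C_complete : cauchy_complete C) (V : lmodType C) (f : semi_inner V) :=
  Completion { cfun :> V -> C; cfunP : cfun \in represented f }.

Section CompletionTheory.
Local Open Scope classical_set_scope.
Variables (C : numClosedFieldType) (half_small : halving C).
Variables (C_complete : cauchy_complete C) (V : lmodType C) (f : semi_inner V).
Local Notation H := (completion half_small C_complete f).

HB.instance Definition _ := [isSub for @cfun C half_small C_complete V f].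
HB.instance Definition _ := [Choice of H by <:].
HB.instance Definition _ := [SubChoice_isSubLmodule of H by <:].

Implicit Types g h : H.

Lemma completionP g : exists2 u, scauchy f u & represents f u g.
Proof. by case: g => g /= /asboolP. Qed.

Definition crepr g : nat -> V := s2val (cid2 (completionP g)).

Lemma crepr_cauchy g : scauchy f (crepr g).
Proof. exact: (s2valP (cid2 (completionP g))). Qed.

Lemma creprP g : represents f (crepr g) g.
Proof. exact: (s2valP' (cid2 (completionP g))). Qed.

Definition cinner g h : C := limn (fun k => f (crepr g k) (crepr h k)).

(** The chosen representatives are exchanged for [u] and [v] one at a time. Each exchange adds a
    product with a sequence representing 0, which vanishes in the limit by [represents0_sip]. *)
Lemma cinner_cvg u v g h : scauchy f u -> represents f u g ->
  scauchy f v -> represents f v h -> f (u k) (v k) @[k --> \oo] --> cinner g h.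
Proof.
move=> cu ug cv vh.
have diff0 w w' x : represents f w x -> represents f w' x ->
    represents f (fun k => (-1) *: w' k + w k) (fun=> 0).
  move=> wx w'x; suff -> : (fun=> 0) = (-1) *: x + x by exact: represents_linear.
  by rewrite scaleN1r addNr.
have cdiff w w' : scauchy f w -> scauchy f w' ->
    scauchy f (fun k => (-1) *: w' k + w k).
  by move=> cw cw'; exact: scauchy_linear.
have cg := crepr_cauchy g; have ch := crepr_cauchy h.
have /C_complete c0 := scauchy_sip cg ch.
have l1 := represents0_sip (cdiff _ _ cu cg) cv (diff0 _ _ _ ug (@creprP g)).
have l2 := represents0_sip (cdiff _ _ cv ch) cg (diff0 _ _ _ vh (@creprP h)).
set w1 := fun k => f _ _ in l1; set w2 := fun k => f _ _ in l2.
have lim : (fun k => f (crepr g k) (crepr h k) + w1 k + (w2 k)^*) @ \oo -->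
    cinner g h + 0 + 0^* by apply: cvgD (cvgn_conj l2); exact: cvgD.
rewrite conjC0 !addr0 in lim; move: lim.
rewrite (_ : (fun k => _ + _) = fun k => f (u k) (v k)) //.
apply/funext => k; rewrite /w1 /w2 -sipC !sip_linear sipDr sipZr rmorphN1.
by ring.
Qed.

End CompletionTheory.

Section CompletionHilbert.
Local Open Scope classical_set_scope.
Variables (C : numClosedFieldType) (half_small : halving C).
Variables (C_complete : cauchy_complete C) (V : lmodType C) (f : semi_inner V).
Local Notation H := (completion half_small C_complete f).
Implicit Types g h : H.

Lemma cinner_eq u v g h (l : C) : scauchy f u -> represents f u g ->
  scauchy f v -> represents f v h ->
  f (u k) (v k) @[k --> \oo] --> l -> cinner g h = l.
Proof. by move=> cu ug cv vh; exact: cvgn_unique (cinner_cvg cu ug cv vh). Qed.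

Lemma crepresents_linear (c : C) u v g h : represents f u g ->
  represents f v h -> represents f (fun k => c *: u k + v k) (c *: g + h).
Proof. exact: represents_linear. Qed.

Let cinner_linear (c : C) g h k :
  cinner (c *: g + h) k = c * cinner g k + cinner h k.
Proof.
have [u cu ug] := completionP g; have [v cv vh] := completionP h.
have [w cw wk] := completionP k.
apply: (cinner_eq (scauchy_linear c cu cv)
  (crepresents_linear (c:=c) ug vh) cw wk).
under eq_fun do rewrite sip_linear.
apply: (cvgD (f := fun k => c * f (u k) (w k))) (cinner_cvg cv vh cw wk).
exact: cvgMl_tmp (cinner_cvg cu ug cw wk).
Qed.

Let cinnerC g h : cinner g h = (cinner h g)^*.
Proof.
have [u cu ug] := completionP g; have [v cv vh] := completionP h.
apply: (cinner_eq cu ug cv vh); under eq_fun do rewrite sipC.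
exact: cvgn_conj (cinner_cvg cv vh cu ug).
Qed.

Let cinner_ge0 g : 0 <= cinner g g.
Proof.
have [u cu ug] := completionP g.
by apply: cvgn_ge0 (cinner_cvg cu ug cu ug) _ => k; exact: sip_ge0.
Qed.

Definition cinner_semi : semi_inner H :=
  SemiInner cinner_linear cinnerC cinner_ge0.

Lemma cemb_subproof (a : V) : f a \in represented f.
Proof.
apply/asboolP; exists (fun=> a); first exact: scauchy_cst.
by move=> b; exact: cvg_cst.
Qed.

Definition cemb (a : V) : H :=
  Completion half_small C_complete (cemb_subproof a).

Lemma cemb_represents a : represents f (fun=> a) (cemb a).
Proof. by move=> b; exact: cvg_cst. Qed.

Lemma cemb_linear (c : C) a b : cemb (c *: a + b) = c *: cemb a + cemb b.
Proof. by apply/val_inj/funext => x; rewrite /= sip_linear. Qed.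

(** A reproducing property, because [cemb a] is represented by a constant sequence. By
    Cauchy-Schwarz an element of norm 0 is then the zero functional, so the norm is definite. *)
Lemma cinner_emb g a : cinner g (cemb a) = g a.
Proof.
have [u cu ug] := completionP g.
exact: (cinner_eq cu ug (@scauchy_cst _ _ _ a) (@cemb_represents a) (ug a)).
Qed.

Lemma completion_norm_eq0 g : snorm cinner_semi g = 0 -> g = 0.
Proof.
move/eqP; rewrite snorm_eq0 => /eqP g0; apply/val_inj/funext => b.
by rewrite -[LHS]/(g b) -cinner_emb; exact: (sip_eq0l (f := cinner_semi)).
Qed.

HB.instance Definition _ := Lmodule_isNormed.Build C H
  (snormD cinner_semi) (snormZ cinner_semi) completion_norm_eq0.

Lemma completion_normE g : `|g| = snorm cinner_semi g.
Proof. by []. Qed.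

Lemma completion_norm_emb a : `|cemb a| = snorm f a.
Proof. by congr sqrtC; rewrite [LHS]cinner_emb. Qed.

Lemma completion_norm_le u g (B : C) :
  0 <= B -> scauchy f u -> represents f u g ->
  (exists p, forall k, (p <= k)%N -> snorm f (u k) <= B) -> `|g| <= B.
Proof.
move=> B0 cu ug [p uB].
rewrite -ler_sqr ?nnegrE // completion_normE snorm_sqr.
apply: cvgn_le (cinner_cvg cu ug cu ug) (cvg_cst (B ^+ 2)) _.
exists p => k pk; rewrite -snorm_sqr ler_sqr ?nnegrE //; exact: uB.
Qed.

Lemma cemb_approx u g (e : C) : 0 <= e -> scauchy f u -> represents f u g ->
  forall p, (forall k, (p <= k)%N -> snorm f (u k - u p) <= e) ->
  `|g - cemb (u p)| <= e.
Proof.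
move=> e0 cu ug p pe.
have -> : g - cemb (u p) = (-1) *: cemb (u p) + g by rewrite scaleN1r addrC.
apply: (completion_norm_le e0 (scauchy_linear (-1) (@scauchy_cst _ _ _ (u p)) cu)
  (crepresents_linear (c:=-1) (@cemb_represents _) ug)).
by exists p => k /pe; rewrite scaleN1r addrC.
Qed.

Lemma cemb_dense g (e : C) : 0 < e -> exists a, `|g - cemb a| <= e.
Proof.
move=> e0; have [u cu ug] := completionP g.
have [p pP] := cu e e0; exists (u p); apply: cemb_approx (ltW e0) cu ug _ _.
by move=> k pk; apply/ltW/pP.
Qed.

Let lt_le_dist (W : normedZmodType C) (x y z : W) (a b : C) :
  `|x - y| < a -> `|y - z| <= b -> `|x - z| < a + b.
Proof.
move=> xy yz; rewrite -(subrK y x) -addrA.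
by apply: le_lt_trans (ler_normD _ _) _; rewrite ltr_leD.
Qed.

Let le_lt_dist (W : normedZmodType C) (x y z : W) (a b : C) :
  `|x - y| <= a -> `|y - z| < b -> `|x - z| < a + b.
Proof.
move=> xy yz; rewrite -(subrK y x) -addrA.
by apply: le_lt_trans (ler_normD _ _) _; rewrite ler_ltD.
Qed.

Let ballE g h (e : C) : ball g e h = (`|g - h| < e).
Proof. by rewrite -ball_normE. Qed.

(** Choose [u k] in [V] such that the ball of radius [2^-k] around its image belongs to [F]. Any two
    of these balls meet, so [u] is Cauchy, and the functional that it represents is the limit of
    [F]. *)
Lemma completion_complete (F : set_system H) :
  ProperFilter F -> cauchy F -> cvg F.
Proof.
move=> FF /cauchyP cF.
have half0 k : 0 < 2^-1 ^+ k :> C by rewrite exprn_gt0 // invr_gt0.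
have halfD k : 2^-1 ^+ k.+1 + 2^-1 ^+ k.+1 = 2^-1 ^+ k :> C.
  by rewrite [RHS]splitr !exprSr.
have half_mono p q : (p <= q)%N -> 2^-1 ^+ q <= 2^-1 ^+ p :> C.
  by move=> pq; apply: ler_wiXn2l; rewrite ?invr_ge0 ?invf_le1 ?ler1n.
have ex k : exists a, F (ball (cemb a) (2^-1 ^+ k)).
  have [x Fx] := cF _ (half0 k.+1).
  have [a xa] := cemb_dense x (half0 k.+1); exists a.
  apply: filterS Fx => y; rewrite !ballE -(halfD k) => xy.
  by apply: le_lt_dist xy; rewrite distrC.
have [u uP] := choice ex.
have dist q q' : snorm f (u q - u q') < 2^-1 ^+ q + 2^-1 ^+ q'.
  have [y []] := filter_ex (filterI (uP q) (uP q')).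
  rewrite !ballE => yq yq'.
  have -> : u q - u q' = (-1) *: u q' + u q by rewrite scaleN1r addrC.
  rewrite -completion_norm_emb cemb_linear scaleN1r addrC.
  by apply: lt_le_dist yq _; rewrite distrC; apply: ltW.
have cu : scauchy f u.
  move=> e e0; have [p pe] := half_small (divr_gt0 e0 (ltr0Sn _ 1)).
  exists p => q q' pq pq'; apply: lt_trans (dist q q') _.
  by rewrite [ltRHS]splitr ltrD // (le_lt_trans _ pe) // half_mono.
have gP : (fun b => limn (fun k => f (u k) b)) \in represented f.
  apply/asboolP; exists u => // b.
  by apply: C_complete; apply: scauchy_sip => //; exact: scauchy_cst.
pose g : H := Completion half_small C_complete gP.
have ug : represents f u g.
  by move=> b; apply: C_complete; apply: scauchy_sip => //; exact: scauchy_cst.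
apply/cvg_ex; exists g; apply/cvg_ballP => e e0.
have e20 : 0 < e / 2 by rewrite divr_gt0.
have [p pe] := half_small (divr_gt0 e20 (ltr0Sn _ 1)).
have gp : `|g - cemb (u p)| <= e / 2.
  apply: cemb_approx (ltW e20) cu ug _ _ => k pk.
  apply/ltW/(lt_trans (dist k p)).
  by rewrite [ltRHS]splitr ltrD // (le_lt_trans _ pe) // half_mono.
have pe' : 2^-1 ^+ p <= e / 2.
  apply/ltW/(lt_le_trans pe).
  by rewrite ler_pdivrMr // ler_peMr ?ler1n // ltW.
apply: filterS (uP p) => y; rewrite !ballE [e]splitr => yp.
exact: le_lt_dist gp (lt_le_trans yp pe').
Qed.

HB.instance Definition _ := Uniform_isComplete.Build H completion_complete.

Lemma cinner_bilinear :
  bilinear_for *%R (Num.conj \; *%R) (@cinner C half_small C_complete V f).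
Proof.
split=> [h c g k|g c h k] /=; first exact: (sip_linear cinner_semi).
have e1 := sipDr cinner_semi (c *: h) k g.
have e2 := sipZr cinner_semi c h g.
exact: etrans e1 (congr1 (+%R^~ _) e2).
Qed.

HB.instance Definition _ := bilinear_isBilinear.Build C H H C *%R
  (Num.conj \; *%R) (@cinner C half_small C_complete V f) cinner_bilinear.

End CompletionHilbert.

(** * GNS construction *)

Section CompletionHilbertType.
Local Open Scope classical_set_scope.
Variables (C : numClosedFieldType) (half_small : halving C).
Variables (C_complete : cauchy_complete C) (V : lmodType C) (f : semi_inner V).
Local Notation H := (completion half_small C_complete f).
Local Notation inn := (@cinner C half_small C_complete V f).

Let cinner_herm (g h : H) : cinner g h = (-1) ^+ false * (cinner h g)^*.
Proof.
rewrite expr0 mul1r; exact: (sipC (cinner_semi half_small C_complete f)).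
Qed.

HB.instance Definition _ :=
  isHermitianSesquilinear.Build C H false Num.conj inn cinner_herm.

Let cinner_gt0 (g : H) : g != 0 -> 0 < cinner g g.
Proof.
move=> g0; rewrite lt0r (sip_ge0 (cinner_semi half_small C_complete f)) andbT.
apply: contra g0 => /eqP g0; apply/eqP/completion_norm_eq0.
by rewrite /snorm -[sip _ g g]/(cinner g g) g0 sqrtC0.
Qed.

HB.instance Definition _ := isDotProduct.Build C H inn cinner_gt0.

Definition cinner_dot : {dot H for Num.conj} := inn.

Let cnorm_sqr (g : H) : `|g| ^+ 2 = cinner_dot g g.
Proof. exact: snorm_sqr. Qed.

HB.instance Definition _ := isHilbert.Build C H cnorm_sqr.

End CompletionHilbertType.

Lemma lipschitz_linear_continuous (K : numFieldType) (U W : normedModType K)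
    (T : {linear U -> W}) (B : K) :
  0 <= B -> (forall x, `|T x| <= B * `|x|) -> continuous T.
Proof.
move=> B0 TB x; apply/cvgrPdist_lt => e e0.
have B1 : 0 < B + 1 by rewrite ltr_wpDl.
apply/nbhs_ballP; exists (e / (B + 1)); first exact: divr_gt0.
move=> y; rewrite -ball_normE /ball_ /= => xy; rewrite -linearB.
apply: le_lt_trans (TB _) _.
apply: le_lt_trans (_ : (B + 1) * `|x - y| < _).
  by rewrite ler_wpM2r // lerDl.
by rewrite mulrC -ltr_pdivlMr.
Qed.

Section GNS.
Local Open Scope classical_set_scope.
Variables (C : numClosedFieldType) (half_small : halving C).
Variables (C_complete : cauchy_complete C) (A : cstarAlgType C).
Variables (omega : {scalar A}) (omega_ge0 : forall a, 0 <= omega (star a * a)).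
Local Notation f := (gns_form omega_ge0).
Local Notation H := (completion half_small C_complete f).
Implicit Types (a b : A) (g h : H).

Lemma gns_scauchyM a u : scauchy f u -> scauchy f (fun k => a * u k).
Proof.
move=> cu e e0.
have K0 : 0 < 2 * cnorm a + 1 by rewrite ltr_wpDl // mulr_ge0.
have [p pP] := cu _ (divr_gt0 e0 K0); exists p => q q' pq pq'.
rewrite -mulrBr; apply: le_lt_trans (gns_snormM _ half_small _ _) _.
apply: le_lt_trans (_ : (2 * cnorm a + 1) * snorm f (u q - u q') < _).
  by rewrite ler_wpM2r // lerDl.
by rewrite mulrC -ltr_pdivlMr // pP.
Qed.

Lemma gns_representsM a u (g : A -> C) : represents f u g ->
  represents f (fun k => a * u k) (fun b => g (star a * b)).
Proof. by move=> ug b; under eq_fun do rewrite gns_form_adjoint; exact: ug. Qed.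

Lemma gns_rep_subproof a g : (fun b => g (star a * b)) \in represented f.
Proof.
have [u cu ug] := completionP g; apply/asboolP; exists (fun k => a * u k).
  exact: gns_scauchyM.
exact: gns_representsM.
Qed.

(** On functionals, left multiplication by [a] becomes precomposition with [star a]. Linearity in
    [g], the unit law and multiplicativity are thus pointwise identities; linearity in [a] concerns
    the argument of [g] and goes through a representing sequence. *)
Definition gns_op a g : H :=
  Completion half_small C_complete (gns_rep_subproof a g).

Lemma gns_opP a u g : represents f u g ->
  represents f (fun k => a * u k) (gns_op a g).
Proof. exact: gns_representsM. Qed.

Lemma gns_op_linear a : linear (gns_op a).
Proof. by move=> c g h; apply/val_inj/funext. Qed.

HB.instance Definition _ a :=
  GRing.isLinear.Build C H H *:%R (gns_op a) (@gns_op_linear a).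

Lemma gns_op_bounded a g : `|gns_op a g| <= 2 * cnorm a * `|g|.
Proof.
have K0 : 0 <= 2 * cnorm a by rewrite mulr_ge0.
have [u cu ug] := completionP g.
rewrite -ler_sqr ?nnegrE ?mulr_ge0 // exprMn !norm_inner.
have cau := gns_scauchyM a cu; have aug := gns_opP (a:=a) ug.
apply: (cvgn_le (cinner_cvg cau aug cau aug)).
  exact: cvgMl_tmp (cinner_cvg cu ug cu ug).
exists 0%N => k _; rewrite -!snorm_sqr -exprMn ler_sqr ?nnegrE ?mulr_ge0 //.
exact: gns_snormM.
Qed.

Lemma gns_op_continuous a : continuous (gns_op a).
Proof.
apply: (lipschitz_linear_continuous _ (gns_op_bounded a)).
by rewrite mulr_ge0.
Qed.

Lemma gns_op_linearl (c : C) a b g :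
  gns_op (c *: a + b) g = c *: gns_op a g + gns_op b g.
Proof.
have [u cu ug] := completionP g.
apply/val_inj/funext => x; have l := @gns_opP (c *: a + b) u g ug x.
suff m : f ((c *: a + b) * u k) x @[k --> \oo] -->
    c * gns_op a g x + gns_op b g x by exact: cvgn_unique l m.
have -> : (fun k => f ((c *: a + b) * u k) x) =
    (fun k => c * f (a * u k) x + f (b * u k) x).
  by apply/funext => k; rewrite mulrDl -scalerAl sip_linear.
apply: (cvgD (f := fun k => c * f (a * u k) x)) (@gns_opP (b) u g ug x).
exact: cvgMl_tmp (@gns_opP (a) u g ug x).
Qed.

Lemma gns_op1 g : gns_op 1 g = g.
Proof. by apply/val_inj/funext => x; rewrite /= star1 mul1r. Qed.

Lemma gns_opM a b g : gns_op (a * b) g = gns_op a (gns_op b g).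
Proof. by apply/val_inj/funext => x; rewrite /= starM mulrA. Qed.

Lemma gns_op_star a g h : inner (gns_op a g) h = inner g (gns_op (star a) h).
Proof.
have [u cu ug] := completionP g; have [v cv vh] := completionP h.
apply: (cinner_eq (gns_scauchyM a cu) (gns_opP (a:=a) ug) cv vh).
under eq_fun do rewrite gns_form_adjoint.
exact: (cinner_cvg cu ug (gns_scauchyM (star a) cv) (gns_opP (a:=star a) vh)).
Qed.

Definition gns_rep : star_representation A H :=
  StarRepresentation gns_op_continuous gns_op_linearl gns_op1 gns_opM
    gns_op_star.

Lemma gns_rep_cyclic a : gns_rep a (cemb half_small C_complete f 1) =
  cemb half_small C_complete f a.
Proof.
by apply/val_inj/funext => x; rewrite /= mulr1 starM starK.
Qed.

Lemma gns_rep_triple : gns_triple omega gns_rep (cemb half_small C_complete f 1).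
Proof.
split=> [a|O [g Og] oO].
  rewrite gns_rep_cyclic -[RHS]/(cinner _ _) cinner_emb -[RHS]/(f a 1).
  by rewrite gns_formE star1 mul1r.
have /nbhs_ballP[e e0 eO] := open_nbhs_nbhs (conj oO Og).
have [a ga] := cemb_dense g (divr_gt0 e0 (ltr0Sn _ 1)).
exists (cemb half_small C_complete f a); split; last first.
  by exists a => //; exact: gns_rep_cyclic.
apply: eO; rewrite -ball_normE /ball_ /=; apply: le_lt_trans ga _.
by rewrite ltr_pdivrMr // ltr_pMr // ltr1n.
Qed.

End GNS.

Lemma gns_exists (C : numClosedFieldType) (A : cstarAlgType C)
    (omega : {scalar A}) : halving C -> cauchy_complete C -> state omega ->
  exists (H : hilbertType C) (pi : star_representation A H) (Omega : H),
    gns_triple omega pi Omega.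
Proof.
move=> half_small C_complete [omega_ge0 _]; do 3!eexists.
exact: (gns_rep_triple half_small C_complete omega_ge0).
Qed.

(** * Completeness of the complex numbers *)

Section ComplexNumbers.
Local Open Scope classical_set_scope.
Variable R : realType.
Local Open Scope complex_scope.

Lemma complex_halving : halving R[i].
Proof.
move=> e e0; have [r er] := complex_realP _ (gtr0_real e0).
move: e0; rewrite er ltcR => r0.
have [k _ /(_ k (leqnn k))] := near_infty_natSinv_expn_lt (PosNum r0).
by rewrite /= div1r -exprVn -ltcR rmorphXn fmorphV rmorph_nat; exists k.
Qed.

Let normc_ge_Im (x : R[i]) : `|complex.Im x|%:C <= `|x|.
Proof.
case: x => a b.
by rewrite normc_def /= lecR -sqrtr_sqr ler_wsqrtr // lerDr sqr_ge0.
Qed.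

Let real_cauchy_cvg (a : nat -> R) :
  (forall e, 0 < e -> exists p, forall q q', (p <= q)%N -> (p <= q')%N ->
    `|a q - a q'| < e) -> cvgn a.
Proof.
move=> ca; apply: (@cauchy_cvg R (a @ \oo)); apply: cauchy_exP => e /ca[p pP].
exists (a p); exists p => // k pk /=; rewrite -ball_normE /ball_ /=.
exact: pP.
Qed.

Let complex_part_cvg (pr : {additive R[i] -> R}) (u : nat -> R[i]) :
  (forall x, `|pr x|%:C <= `|x|) -> norm_cauchy Num.norm u -> cvgn (pr \o u).
Proof.
move=> prP cu; apply: real_cauchy_cvg => e e0.
have ec0 : 0 < e%:C :> R[i] by rewrite ltcR.
have [p pP] := cu _ ec0; exists p => k k' pk pk'; rewrite -ltcR -raddfB.
exact: le_lt_trans (prP _) (pP _ _ pk pk').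
Qed.

Lemma complex_complete : cauchy_complete R[i].
Proof.
move=> u cu.
have cre := complex_part_cvg (@normc_ge_Re _) cu.
have cim := complex_part_cvg normc_ge_Im cu.
have norm_le (x : R[i]) : `|x| <= `|complex.Re x|%:C + `|complex.Im x|%:C.
  rewrite {1}[x]complexE; apply: le_trans (ler_normD _ _) _.
  rewrite normrM [`|'i|](_ : _ = 1) ?mul1r; last first.
    by rewrite normc_def /= expr0n expr1n add0r sqrtr1.
  by rewrite !normc_def /= !expr0n !addr0 !sqrtr_sqr.
apply/cvg_ex; exists (limn (@complex.Re R \o u) +i* limn (@complex.Im R \o u)).
apply: lt_cvgn => e e0; have [r er] := complex_realP _ (gtr0_real e0).
move: e0; rewrite er ltcR => r0; have r20 : 0 < r / 2 by rewrite divr_gt0.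
have /cvgrPdistC_lt /(_ _ r20) [p _ pP] := cre.
have /cvgrPdistC_lt /(_ _ r20) [q _ qP] := cim.
exists (maxn p q) => k; rewrite geq_max => /andP[pk qk].
apply: le_lt_trans (norm_le _) _; rewrite [r]splitr -rmorphD ltcR.
move: (pP _ pk) (qP _ qk); rewrite /=; case: (u k) => a b /=.
exact: ltrD.
Qed.

End ComplexNumbers.

(** * Geometric words in a Cuntz family *)

Section GeometricWords.
Variables (C : numClosedFieldType) (A : cstarAlgType C) (n : nat).
Variables (n_ge2 : (2 <= n)%N) (s : n.-tuple A) (s_cuntz : cuntz_family s).
Local Notation sn := (s`_n.-1).

Let d_gt0 : (0 < n.-1)%N. Proof. by case: n n_ge2 => [|[]]. Qed.
Let d_lt : (n.-1 < n)%N. Proof. by rewrite prednK // ltnW. Qed.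
Let lt_dn i : (i < n.-1)%N -> (i < n)%N.
Proof. by move=> /ltn_trans; exact. Qed.

Lemma cuntz_ortho i j : (i < n)%N -> (j < n)%N ->
  star s`_i * s`_j = (i == j)%:R.
Proof. by move=> i_n j_n; rewrite (s_cuntz.1 (Ordinal i_n) (Ordinal j_n)). Qed.

(* [gp_word ((n-1) r + i)] is s_n^r s_(i+1), for i < n-1. *)
Definition gp_word j : A := sn ^+ (j %/ n.-1) * s`_(j %% n.-1).

Lemma gp_word_small i : (i < n.-1)%N -> gp_word i = s`_i.
Proof. by move=> id; rewrite /gp_word divn_small // mul1r modn_small. Qed.

Lemma gp_wordD q j : gp_word (n.-1 * q + j) = sn ^+ q * gp_word j.
Proof.
by rewrite /gp_word mulnC divnMDl // modnMDl exprD mulrA.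
Qed.

Lemma gp_wordS j : gp_word (n.-1 + j) = sn * gp_word j.
Proof. by have := gp_wordD 1 j; rewrite muln1 expr1. Qed.

Lemma gp_index_ind (P : nat -> Prop) : (forall i, (i < n.-1)%N -> P i) ->
  (forall j, P j -> P (n.-1 + j)%N) -> forall j, P j.
Proof.
move=> P0 PS; elim/ltn_ind => j IH; have [|dj] := ltnP j n.-1; first exact: P0.
by rewrite -(subnKC dj); apply/PS/IH; rewrite ltn_subrL d_gt0 (leq_trans d_gt0).
Qed.

Lemma starX_isometry k : star (sn ^+ k) * sn ^+ k = 1.
Proof.
elim: k => [|k IH]; first by rewrite expr0 star1 mulr1.
rewrite exprS starM -mulrA (mulrA (star sn)) cuntz_ortho // eqxx mul1r.
exact: IH.
Qed.

(** Common leading factors [s_n] cancel. Once one word is a single generator other than [s_n],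
    orthogonality of the generators decides. *)
Lemma gp_word_ortho i j : star (gp_word i) * gp_word j = (i == j)%:R.
Proof.
elim/gp_index_ind: i j => [i id|i IH]; elim/gp_index_ind => [j jd|j _].
- by rewrite !gp_word_small // cuntz_ortho ?(lt_dn id) ?(lt_dn jd).
- rewrite gp_wordS gp_word_small // mulrA cuntz_ortho ?(lt_dn id) //.
  by rewrite (ltn_eqF id) (ltn_eqF (ltn_addr _ id)) mul0r.
- rewrite gp_wordS (gp_word_small jd) starM -mulrA cuntz_ortho ?(lt_dn jd) //.
  by rewrite (gtn_eqF jd) (gtn_eqF (ltn_addr _ jd)) mulr0.
- rewrite !gp_wordS starM -mulrA (mulrA (star sn)) cuntz_ortho // eqxx mul1r.
  by rewrite IH eqn_add2l.
Qed.

(** Such a word has fewer than [k] factors [s_n] before its last generator, which therefore meets a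
    further [s_n]. Hence [s_n^k] can be adjoined to these words to form an orthonormal family. *)
Lemma star_gp_word_pow k j : (j < n.-1 * k)%N -> star (gp_word j) * sn ^+ k = 0.
Proof.
elim: k j => [|k IH] j; first by rewrite muln0.
elim/gp_index_ind: j => [i id _|j _]; rewrite exprS mulrA.
  by rewrite gp_word_small // cuntz_ortho ?(lt_dn id) // ltn_eqF // !mul0r.
rewrite mulnS ltn_add2l gp_wordS starM -(mulrA _ _ sn) cuntz_ortho // eqxx mulr1.
exact: IH.
Qed.

(** * Levels modulo a left ideal, and their density *)

Section Filtration.
Variables (N : A -> Prop) (z : nat -> C).
Hypothesis N_linear : forall c x y, N x -> N y -> N (c *: x + y).
Hypothesis N_ideal : forall a x, N x -> N (a * x).
Hypothesis N_word : forall j, N (star (gp_word j) - z j *: 1).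

(* Modulo the left ideal [N], level [L] consists of the elements that all
   products of [L] adjoints of words map to scalars. *)
Fixpoint gp_filt L (a : A) : Prop :=
  if L is L'.+1 then forall j, gp_filt L' (star (gp_word j) * a)
  else exists c : C, N (a - c *: 1).

Lemma gp_filt_linear L c a b :
  gp_filt L a -> gp_filt L b -> gp_filt L (c *: a + b).
Proof.
elim: L a b => [|L IH] a b /=.
  move=> [c1 Na] [c2 Nb]; exists (c * c1 + c2).
  by rewrite scalerDl opprD addrACA -scalerA -scalerBr; exact: N_linear.
by move=> Fa Fb j; rewrite mulrDr -scalerAr; apply: IH.
Qed.

Let N0 : N 0.
Proof. by have := N_ideal 0 (N_word 0); rewrite mul0r. Qed.

Lemma gp_filt0 L : gp_filt L 0.
Proof.
elim: L => [|L IH] /=; first by exists 0; rewrite scale0r subr0.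
by move=> j; rewrite mulr0.
Qed.

(** Modulo [N] the adjoint of the word [j] sends [c 1] to [c z_j 1]. This starts the induction that
    makes the levels increasing. *)
Lemma gp_filt_word_scalar j a : gp_filt 0 a -> gp_filt 0 (star (gp_word j) * a).
Proof.
move=> [c Na]; exists (c * z j).
have -> : star (gp_word j) * a - (c * z j) *: 1 =
    1 *: (star (gp_word j) * (a - c *: 1)) +
    (c *: (star (gp_word j) - z j *: 1) + 0).
  rewrite scale1r addr0 mulrBr -scalerAr mulr1 scalerBr scalerA.
  by rewrite addrA subrK.
by apply: N_linear; [exact: N_ideal | exact: N_linear].
Qed.

Lemma gp_filtS L a : gp_filt L a -> gp_filt L.+1 a.
Proof.
elim: L a => [|L IH] a Fa j; first exact: gp_filt_word_scalar.
exact/IH/Fa.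
Qed.

Lemma gp_filt_mono L M a : (L <= M)%N -> gp_filt L a -> gp_filt M a.
Proof.
move=> /subnK <-; elim: (M - L)%N => [//|k IH] /IH; exact: gp_filtS.
Qed.

(** The adjoint of a word times [s_n] is either 0 or the adjoint of the word with one factor [s_n]
    removed. *)
Lemma gp_filt_sn L a : gp_filt L a -> gp_filt L.+1 (sn * a).
Proof.
move=> /gp_filtS Fa; elim/gp_index_ind => [i id|j _]; rewrite mulrA.
  rewrite gp_word_small // cuntz_ortho ?(lt_dn id) // ltn_eqF // mul0r.
  exact: gp_filt0.
rewrite gp_wordS starM -(mulrA _ _ sn) cuntz_ortho // eqxx mulr1.
exact: Fa.
Qed.

(** Here the adjoint of a word is multiplied into the adjoint of a longer word, with one more factor
    [s_n]. *)
Lemma gp_filt_star_sn L a : gp_filt L a -> gp_filt L.+1 (star sn * a).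
Proof.
move=> /gp_filtS Fa j; rewrite mulrA -starM -gp_wordS; exact: Fa.
Qed.

Lemma gp_filt_gen L i a : (i < n)%N -> gp_filt L a -> gp_filt L.+1 (s`_i * a).
Proof.
move=> i_n Fa; have [id|di] := ltnP i n.-1; last first.
  have -> : i = n.-1.
    by apply/eqP; rewrite eqn_leq di andbT -ltnS prednK // ltnW.
  exact: gp_filt_sn.
move=> j; rewrite -(gp_word_small id) mulrA gp_word_ortho.
by case: eqP => _; rewrite ?mul1r ?mul0r //; exact: gp_filt0.
Qed.

Lemma gp_filt_star_gen L i a :
  (i < n)%N -> gp_filt L a -> gp_filt L.+1 (star s`_i * a).
Proof.
move=> i_n Fa; have [id|di] := ltnP i n.-1; last first.
  have -> : i = n.-1.
    by apply/eqP; rewrite eqn_leq di andbT -ltnS prednK // ltnW.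
  exact: gp_filt_star_sn.
by rewrite -(gp_word_small id); apply/gp_filtS/(gp_filtS Fa).
Qed.

Definition gp_closure (a : A) : Prop :=
  forall e : C, 0 < e -> exists L b, gp_filt L b /\ cnorm (a - b) < e.

Lemma gp_closure_linear c a b :
  gp_closure a -> gp_closure b -> gp_closure (c *: a + b).
Proof.
move=> ca cb e e0.
have c0 : 0 < `|c| + 1 by rewrite ltr_wpDl.
have e20 := divr_gt0 e0 (ltr0Sn _ 1).
have [L [a' [Fa aa']]] := ca _ (divr_gt0 e20 c0).
have [M [b' [Fb bb']]] := cb _ e20.
exists (maxn L M), (c *: a' + b'); split.
  by apply: gp_filt_linear; [apply: gp_filt_mono Fa | apply: gp_filt_mono Fb];
    rewrite ?leq_maxl ?leq_maxr.
rewrite opprD addrACA -scalerBr; apply: le_lt_trans (cnormD _ _) _.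
rewrite cnormZ [ltRHS]splitr; apply: ler_ltD => //.
apply: le_trans (_ : (`|c| + 1) * cnorm (a - a') <= _).
  by rewrite ler_wpM2r // lerDl.
by rewrite mulrC -ler_pdivlMr // ltW.
Qed.

Lemma gp_closure_closed (u : nat -> A) a :
  (forall q, gp_closure (u q)) -> norm_cvg cnorm u a -> gp_closure a.
Proof.
move=> cu ua e e0; have e20 := divr_gt0 e0 (ltr0Sn _ 1).
have [p /(_ p (leqnn p)) pP] := ua _ e20.
have [L [b [Fb ub]]] := cu p _ e20; exists L, b; split=> //.
apply: le_lt_trans (cnormB_trans (u p) _ _) _.
by rewrite [ltRHS]splitr ltrD // cnorm_distrC.
Qed.

Lemma gp_closure_mul (x : A) : (forall L a, gp_filt L a -> gp_closure (x * a)) ->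
  forall a, gp_closure a -> gp_closure (x * a).
Proof.
move=> xF a ca e e0; have e20 := divr_gt0 e0 (ltr0Sn _ 1).
have K0 : 0 < cnorm x + 1 by rewrite ltr_wpDl.
have [L [b [Fb ab]]] := ca _ (divr_gt0 e20 K0).
have [M [c [Fc xbc]]] := xF _ _ Fb _ e20; exists M, c; split=> //.
apply: le_lt_trans (cnormB_trans (x * b) _ _) _.
rewrite [ltRHS]splitr ltrD // -mulrBr; apply: le_lt_trans (cnormM _ _) _.
apply: le_lt_trans (_ : (cnorm x + 1) * cnorm (a - b) < _).
  by rewrite ler_wpM2r // lerDl.
by rewrite mulrC -ltr_pdivlMr.
Qed.

Lemma gp_filt_closure L a : gp_filt L a -> gp_closure a.
Proof. by move=> Fa e e0; exists L, a; rewrite subrr cnorm0. Qed.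

(** The elements that, together with their adjoints, preserve [gp_closure] under left multiplication
    form a norm-closed star-subalgebra containing the generators, hence everything. Apply this to 1,
    which has level 0. *)
Lemma gp_filt_dense : cstar_generated s -> forall a, gp_closure a.
Proof.
move=> s_gen a.
pose S := [set x | (forall b, gp_closure b -> gp_closure (x * b)) /\
  (forall b, gp_closure b -> gp_closure (star x * b))]%classic.
have clim (u : nat -> A) x b : (forall q, gp_closure (u q * b)) ->
    norm_cvg cnorm u x -> gp_closure (x * b).
  move=> ub ux; apply: gp_closure_closed ub _ => e e0.
  have K0 : 0 < cnorm b + 1 by rewrite ltr_wpDl.
  have [p pP] := ux _ (divr_gt0 e0 K0); exists p => q pq.
  rewrite -mulrBl; apply: le_lt_trans (cnormM _ _) _.
  apply: le_lt_trans (_ : cnorm (u q - x) * (cnorm b + 1) < _).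
    by rewrite ler_wpM2l // lerDl.
  by rewrite -ltr_pdivlMr // pP.
have ST : S = setT.
  apply: s_gen.
  - move=> u x Su ux; split=> b cb.
      by apply: clim ux => q; apply: (Su q).1.
    apply: (clim (fun q => star (u q))) => [q|e /ux[p pP]].
      by apply: (Su q).2.
    by exists p => q pq; rewrite -starB cnorm_star pP.
  - split.
    + by split=> b; rewrite ?star1 mul1r.
    + move=> c x y [Sx Sx'] [Sy Sy']; split=> b cb.
        rewrite mulrDl -scalerAl; apply: gp_closure_linear; auto.
      by rewrite starD starZ mulrDl -scalerAl; apply: gp_closure_linear; auto.
    + move=> x y [Sx Sx'] [Sy Sy']; split=> b cb.
        by rewrite -mulrA; auto.
      by rewrite starM -mulrA; auto.
    + by move=> x [Sx Sx']; split; rewrite ?starK.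
  - move=> i; split; apply: gp_closure_mul => L b Fb.
      by apply: (@gp_filt_closure L.+1); apply: gp_filt_gen.
    by apply: (@gp_filt_closure L.+1); apply: gp_filt_star_gen.
have [Sa _] : S a by rewrite ST.
rewrite -(mulr1 a); apply: Sa; apply: (@gp_filt_closure 0).
by exists 1; rewrite scale1r subrr.
Qed.

Lemma gp_filt_pow (T : A) (w : nat -> C) (M : nat) L a :
  T = \sum_(j < M) w j *: star (gp_word j) -> gp_filt L a ->
  gp_filt 0 (T ^+ L * a).
Proof.
move=> defT; elim: L a => [|L IH] a Fa; first by rewrite mul1r.
rewrite exprSr -mulrA; apply: IH; rewrite defT mulr_suml.
elim: M {defT} => [|M IHM]; first by rewrite big_ord0; exact: gp_filt0.
rewrite big_ord_recr /= addrC -scalerAl; apply: gp_filt_linear => //; exact: Fa.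
Qed.

End Filtration.
End GeometricWords.

(** * States with prescribed values on geometric words *)

Section States.
Variables (C : numClosedFieldType) (half_small : halving C).
Variables (A : cstarAlgType C) (n : nat) (n_ge2 : (2 <= n)%N) (s : n.-tuple A).
Variables (s_cuntz : cuntz_family s) (s_gen : cstar_generated s).
Implicit Types (omega : {scalar A}) (z w : nat -> C) (M L j : nat).
Local Notation t := (gp_word s).

Section OneState.
Variables (omega : {scalar A}) (omega_state : state omega).
Local Notation f := (gns_form omega_state.1).

Definition null (x : A) : Prop := f x x = 0.

(** The eigenvector equation [t_j^* Omega = z_j Omega] of the GNS space, expressed in the algebra
    itself. *)
Definition word_null z := forall j, null (star (t j) - z j *: 1).

Lemma state1 : omega 1 = 1. Proof. exact: omega_state.2. Qed.

Lemma snorm1 : snorm f 1 = 1.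
Proof. by rewrite /snorm gns_formE star1 mul1r state1 sqrtC1. Qed.

Lemma null_state x : null x -> omega x = 0.
Proof.
move=> x0; have := sip_eq0l 1 x0.
by rewrite gns_formE star1 mul1r.
Qed.

Lemma null_linear c x y : null x -> null y -> null (c *: x + y).
Proof. exact: sip_null_linear. Qed.

Lemma null_ideal a x : null x -> null (a * x).
Proof. exact: gns_form_null_left_ideal. Qed.

Lemma norm_state_le a : `|omega a| <= 2 * cnorm a.
Proof.
have := le_sip_snorm f a 1; rewrite gns_formE star1 mul1r snorm1 mulr1.
move/le_trans; apply; have := gns_snormM omega_state.1 half_small a 1.
by rewrite mulr1 snorm1 mulr1.
Qed.

(* Bessel's inequality in the GNS space, for an orthonormal family of
   translates of the cyclic vector. *)
Lemma orthonormal_null_bound (u : nat -> A) M :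
  (forall i j, (i < M)%N -> (j < M)%N -> star (u i) * u j = (i == j)%:R) ->
  forall i, (i < M)%N ->
    f (star (u i) - (omega (u i))^* *: 1)
      (star (u i) - (omega (u i))^* *: 1) <=
    1 - \sum_(j < M) `|omega (u j)| ^+ 2.
Proof.
move=> u_ortho i iM.
pose g j := f (star (u j) - (omega (u j))^* *: 1)
  (star (u j) - (omega (u j))^* *: 1).
have gE j : g j = omega (u j * star (u j)) - `|omega (u j)| ^+ 2.
  have -> : g j = f (star (u j)) (star (u j))
      - ((omega (u j))^*)^* * f (star (u j)) 1
      - (omega (u j))^* * (f (star (u j)) 1)^*
      + `|(omega (u j))^*| ^+ 2 * f 1 1 by rewrite /g sip_sqr_axpy.
  rewrite !gns_formE starK star1 !mul1r (state_star omega_state.1) state1 conjCK.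
  by rewrite norm_conjC normCK; ring.
pose P := \sum_(j < M) u j * star (u j).
(* [P] is the range projection of the family; positivity at [1 - P] yields [omega P <= 1]. *)
have PP : star (1 - P) * (1 - P) = 1 - P.
  have starP : star P = P.
    by rewrite star_sum; apply: eq_bigr => j _; rewrite starM starK.
  have P2 : P * P = P.
    rewrite {1}/P mulr_suml; apply: eq_bigr => j _.
    rewrite mulr_sumr (bigD1 j) //= big1 ?addr0 => [|k kj].
      by rewrite !mulrA -(mulrA (u j)) u_ortho // eqxx mulr1.
    rewrite !mulrA -(mulrA (u j)) u_ortho // eq_sym val_eqE.
    by rewrite (negPf kj) mulr0 mul0r.
  by rewrite starB star1 starP mulrBl mul1r mulrBr mulr1 P2 subrr subr0.
have sumg : \sum_(j < M) g j <= 1 - \sum_(j < M) `|omega (u j)| ^+ 2.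
  have -> : \sum_(j < M) g j = omega P - \sum_(j < M) `|omega (u j)| ^+ 2.
    by rewrite raddf_sum -sumrB; apply: eq_bigr => j _; exact: gE.
  rewrite lerD2r -subr_ge0 -state1 -linearB -PP; exact: omega_state.1.
apply: le_trans sumg; rewrite (bigD1 (Ordinal iM)) //= lerDl.
by apply: sumr_ge0 => j _; exact: sip_ge0.
Qed.

End OneState.

Definition tau z M : A := \sum_(j < M) z j *: t j.

Lemma star_tau z M : star (tau z M) = \sum_(j < M) (z j)^* *: star (t j).
Proof. by rewrite star_sum; apply: eq_bigr => j _; rewrite starZ. Qed.

Lemma star_tau_tau z w M :
  star (tau z M) * tau w M = (\sum_(j < M) (z j)^* * w j) *: 1.
Proof.
rewrite star_tau mulr_suml scaler_suml; apply: eq_bigr => i _.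
rewrite mulr_sumr (bigD1 i) //= big1 ?addr0 => [|j ji].
  by rewrite -scalerAl -scalerAr gp_word_ortho // eqxx scalerA.
rewrite -scalerAl -scalerAr gp_word_ortho // eq_sym val_eqE (negPf ji).
by rewrite !scaler0.
Qed.

Definition mass z M : C := \sum_(j < M) `|z j| ^+ 2.

Lemma massE z M : mass z M = \sum_(j < M) (z j)^* * z j.
Proof. by apply: eq_bigr => j _; rewrite normCK mulrC. Qed.

Lemma mass_ge0 z M : 0 <= mass z M.
Proof. by apply: sumr_ge0 => j _; rewrite exprn_ge0. Qed.

Section Tau.
Variables (omega : {scalar A}) (omega_state : state omega).
Local Notation f := (gns_form omega_state.1).

Lemma star_tau_null z w M : word_null omega_state w ->
  null omega_state (star (tau z M) - (\sum_(j < M) (z j)^* * w j) *: 1).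
Proof.
move=> wP; rewrite star_tau scaler_suml -sumrB.
elim: M => [|M IH]; first by rewrite big_ord0 /null sip0l.
rewrite big_ord_recr /= addrC -scalerA -scalerBr.
by apply: null_linear => //; exact: wP.
Qed.

(** [omega] takes the value [p = mass z M] on [tau], on its adjoint and on [star tau * tau], so the
    square expands to [1 - 2p + p]. *)
Lemma tau_dist z M : word_null omega_state z ->
  f (1 - tau z M) (1 - tau z M) = 1 - mass z M.
Proof.
move=> zP; rewrite gns_formE starB star1 mulrBl mul1r mulrBr mulr1 star_tau_tau.
have eT : omega (star (tau z M)) = mass z M.
  have := null_state (star_tau_null z M zP); rewrite linearB /=.
  rewrite (scalar_linearZ omega) (state1 omega_state) mulr1 -massE => /eqP.
  by rewrite subr_eq0 => /eqP.
have eT' : omega (tau z M) = mass z M.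
  rewrite -(starK (tau z M)) (state_star omega_state.1) eT.
  by apply/CrealP/ger0_real/mass_ge0.
rewrite !linearB /= eT eT' (state1 omega_state) (scalar_linearZ omega) -massE.
by rewrite (state1 omega_state); ring.
Qed.

Lemma mass_le1 z M : word_null omega_state z -> mass z M <= 1.
Proof. by move=> zP; rewrite -subr_ge0 -tau_dist // sip_ge0. Qed.

Lemma snorm_tau z M x : word_null omega_state z ->
  snorm f (tau z M * x) <= snorm f x.
Proof.
move=> zP; rewrite -ler_sqr ?nnegrE // !snorm_sqr.
have -> : f (tau z M * x) (tau z M * x) = mass z M * f x x.
  rewrite !gns_formE starM mulrA -(mulrA (star x)) star_tau_tau -massE.
  by rewrite -scalerAr -scalerAl mulr1 (scalar_linearZ omega).
by rewrite -[leRHS]mul1r ler_wpM2r ?sip_ge0 // mass_le1.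
Qed.

(** Telescoping: each further factor [tau] is a contraction and costs one more distance from [tau]
    to 1. *)
Lemma tau_pow_dist z M L : word_null omega_state z ->
  snorm f (1 - tau z M ^+ L) <= L%:R * sqrtC (1 - mass z M).
Proof.
move=> zP; elim: L => [|L IH]; first by rewrite subrr snorm0 mul0r.
have -> : 1 - tau z M ^+ L.+1 = 1 - tau z M + tau z M * (1 - tau z M ^+ L).
  by rewrite mulrBr mulr1 exprS addrA subrK.
apply: le_trans (snormD _ _ _) _; rewrite -natr1 mulrDl mul1r addrC.
apply: lerD; first exact: le_trans (snorm_tau _ _ zP) IH.
by rewrite /snorm tau_dist.
Qed.

(* The cyclic vector is nearly fixed by [tau z M], so that the state is nearly
   invariant under left multiplication by the adjoint. *)
Lemma state_approx z M L a c : word_null omega_state z ->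
  null omega_state (star (tau z M) ^+ L * a - c *: 1) ->
  `|omega a - c| <= snorm f a * (L%:R * sqrtC (1 - mass z M)).
Proof.
move=> zP aN; have <- : omega (star (tau z M) ^+ L * a) = c.
  apply/eqP; rewrite -subr_eq0 -(null_state aN) linearB (scalar_linearZ omega).
  by rewrite (state1 omega_state) mulr1.
have -> : omega a - omega (star (tau z M) ^+ L * a) = f a (1 - tau z M ^+ L).
  by rewrite gns_formE starB star1 starX mulrBl mul1r linearB.
apply: le_trans (le_sip_snorm _ _ _) _.
by rewrite ler_wpM2l // tau_pow_dist.
Qed.

End Tau.

(** A one-sided form of convergence of the mass to 1; the bound from above is [mass_le1]. *)
Definition full_mass z :=
  forall e : C, 0 < e -> exists M0, forall M, (M0 <= M)%N -> 1 - mass z M < e.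

(** [N] is kept abstract because it is taken to be the null space of one state or the intersection
    of those of two. *)
Lemma star_tau_filt N z w M L a :
  (forall c x y, N x -> N y -> N (c *: x + y)) ->
  (forall a x, N x -> N (a * x)) ->
  (forall j, N (star (t j) - w j *: 1)) ->
  gp_filt s N L a -> exists c : C, N (star (tau z M) ^+ L * a - c *: 1).
Proof.
move=> Nlin Nid Nw Fa.
exact: (@gp_filt_pow _ _ _ _ N w Nlin Nid Nw _ (fun j => (z j)^*) M L a
  (star_tau z M) Fa).
Qed.

Lemma state_unique omega omega' z (S : state omega) (S' : state omega') :
  word_null S z -> word_null S' z -> full_mass z -> omega =1 omega'.
Proof.
move=> zP zP' z1.
(* Intersecting the null spaces provides a single scalar [c] that serves both states. *)
pose N x := null S x /\ null S' x.
have Nlin c x y : N x -> N y -> N (c *: x + y).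
  by move=> [? ?] [? ?]; split; exact: null_linear.
have Nid a x : N x -> N (a * x).
  by move=> [? ?]; split; exact: null_ideal.
have Nz j : N (star (t j) - z j *: 1) by split; [exact: zP | exact: zP'].
have small (x : C) : (forall e : C, 0 < e -> `|x| <= e) -> x = 0.
  move=> xe; apply/eqP; rewrite -normr_le0; apply/ler_addgt0Pr => e /xe.
  by rewrite add0r.
have eq_filt L b : gp_filt s N L b -> omega b = omega' b.
  move=> Fb; apply/eqP; rewrite -subr_eq0; apply/eqP/small => e e0.
  pose B := snorm (gns_form S.1) b * L%:R + snorm (gns_form S'.1) b * L%:R.
  have B0 : 0 <= B by rewrite addr_ge0 // mulr_ge0.
  have B1 : 0 < B + 1 by rewrite ltr_wpDl.
  (* The square compensates the square root in [state_approx], and [B + 1] avoids a division by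
     0. *)
  have [M /(_ M (leqnn M)) Mz] := z1 _ (exprn_gt0 2 (divr_gt0 e0 B1)).
  have [c [cN cN']] := star_tau_filt z M Nlin Nid Nz Fb.
  have q : sqrtC (1 - mass z M) <= e / (B + 1).
    rewrite -ler_sqr ?nnegrE ?sqrtC_ge0 ?subr_ge0 ?(mass_le1 _ zP) //.
      by rewrite sqrtCK ltW.
    by rewrite divr_ge0 // ltW.
  rewrite -(subrK c (omega b)) -addrA; apply: le_trans (ler_normD _ _) _.
  rewrite -(normrN (c - _)) opprB.
  apply: le_trans (lerD (state_approx zP cN) (state_approx zP' cN')) _.
  rewrite !mulrA -mulrDl -/B.
  apply: le_trans (_ : B * (e / (B + 1)) <= _); first by rewrite ler_wpM2l.
  by rewrite mulrCA ler_piMr ?(ltW e0) // ler_pdivrMr // mul1r lerDl.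
move=> a; apply/eqP; rewrite -subr_eq0; apply/eqP/small => e e0.
(* Each of the two states contributes [2 cnorm (a - b)] through [norm_state_le]. *)
have e4 : 0 < e / 4 by rewrite divr_gt0.
have [L [b [Fb ab]]] := gp_filt_dense n_ge2 s_cuntz Nlin Nid Nz s_gen a e4.
have -> : omega a - omega' a = omega (a - b) - omega' (a - b).
  by rewrite !raddfB /= (eq_filt _ _ Fb) opprK [- _ + _]addrC addrA subrK.
apply: le_trans (ler_normB _ _) _.
apply: le_trans (lerD (norm_state_le S _) (norm_state_le S' _)) _.
rewrite -mulrDl -natrD mulrC -ler_pdivlMr //; exact: ltW.
Qed.

End States.

(** * Vectors in a common representation *)

Section HilbertSemiInner.
Local Open Scope classical_set_scope.
Variables (C : numClosedFieldType) (H : hilbertType C).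

Let inner_linear (c : C) (x y z : H) :
  inner (c *: x + y) z = c * inner x z + inner y z.
Proof. exact: linearPl. Qed.

Let innerC (x y : H) : inner x y = (inner y x)^*.
Proof. by rewrite (hermC (inner : {dot H for Num.conj})) expr0 mul1r. Qed.

Let inner_ge0 (x : H) : 0 <= inner x x.
Proof. by rewrite -norm_inner exprn_ge0. Qed.

Definition hilbert_form : semi_inner H := SemiInner inner_linear innerC inner_ge0.

Lemma hilbert_normE (x : H) : `|x| = snorm hilbert_form x.
Proof. by rewrite /snorm -[sip _ x x]/(inner x x) -norm_inner sqrCK. Qed.

Lemma norm_inner_le (x y : H) : `|inner x y| <= `|x| * `|y|.
Proof. rewrite !hilbert_normE; exact: (le_sip_snorm hilbert_form). Qed.

End HilbertSemiInner.

Section Representations.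
Local Open Scope classical_set_scope.
Variables (C : numClosedFieldType) (A : cstarAlgType C) (H : hilbertType C).
Variable pi : star_representation A H.

Lemma repD a b x : pi (a + b) x = pi a x + pi b x.
Proof. by have := rep_linear pi 1 a b x; rewrite !scale1r. Qed.

Lemma rep0 x : pi 0 x = 0.
Proof. by apply: (@addrI _ (pi 0 x)); rewrite -repD !addr0. Qed.

Lemma repZ c a x : pi (c *: a) x = c *: pi a x.
Proof. by have := rep_linear pi c a 0 x; rewrite rep0 !addr0. Qed.

Lemma repB a b x : pi (a - b) x = pi a x - pi b x.
Proof. by rewrite repD -scaleN1r repZ scaleN1r. Qed.

Lemma rep_scalar c x : pi (c *: 1) x = c *: x.
Proof. by rewrite repZ rep1. Qed.

Section VectorState.
Variables (omega : {scalar A}) (omega_ge0 : forall a, 0 <= omega (star a * a)).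
Variables (Omega : H) (OmegaP : forall a, omega a = inner (pi a Omega) Omega).

Lemma norm_rep_vector a : `|pi a Omega| = snorm (gns_form omega_ge0) a.
Proof.
rewrite hilbert_normE /snorm -[sip _ _ _]/(inner (pi a Omega) (pi a Omega)).
by rewrite gns_formE OmegaP repM !rep_star starK.
Qed.

Lemma rep_null_vector a c :
  gns_form omega_ge0 (a - c *: 1) (a - c *: 1) = 0 -> pi a Omega = c *: Omega.
Proof.
move=> a0; apply/eqP; rewrite -subr_eq0 -rep_scalar -repB -normr_eq0.
by rewrite norm_rep_vector snorm_eq0 a0.
Qed.

End VectorState.
End Representations.

(** * Equality of the parameters of two vectors in one representation *)

Section Inequivalence.
Local Open Scope classical_set_scope.
Variables (C : numClosedFieldType) (half_small : halving C).
Variables (A : cstarAlgType C) (n : nat) (n_ge2 : (2 <= n)%N) (s : n.-tuple A).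
Variables (s_cuntz : cuntz_family s) (s_gen : cstar_generated s).
Variables (H : hilbertType C) (pi : star_representation A H).
Variables (omega1 omega2 : {scalar A}) (S1 : state omega1) (S2 : state omega2).
Variables (Omega1 Omega2 : H).
Hypothesis Omega1P : forall a, omega1 a = inner (pi a Omega1) Omega1.
Hypothesis Omega2P : forall a, omega2 a = inner (pi a Omega2) Omega2.
Hypothesis Omega2_cyclic : dense (range (fun a => pi a Omega2)).
Variables (z w : nat -> C).
Hypotheses (zP : word_null s S1 z) (wP : word_null s S2 w).
Hypothesis z_full : full_mass z.

Local Notation lambda M := (\sum_(j < M) (z j)^* * w j).

Let normO1 : `|Omega1| = 1.
Proof. by rewrite -(rep1 pi Omega1) (norm_rep_vector S1.1 Omega1P) snorm1. Qed.

Let normO2 : `|Omega2| = 1.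
Proof. by rewrite -(rep1 pi Omega2) (norm_rep_vector S2.1 Omega2P) snorm1. Qed.

Lemma rep_star_tau1 M : pi (star (tau s z M)) Omega1 = mass z M *: Omega1.
Proof.
rewrite massE; exact: (rep_null_vector Omega1P (star_tau_null z M zP)).
Qed.

Lemma rep_star_tau2 M : pi (star (tau s z M)) Omega2 = lambda M *: Omega2.
Proof. exact: (rep_null_vector Omega2P (star_tau_null z M wP)). Qed.

(** [tau] acts as a contraction because [star tau * tau] is the scalar [mass z M], at most 1. With
    [y] the image of [x], the bound passes to the adjoint by Cauchy-Schwarz in
    [|y|^2 = <x, tau y>]. *)
Lemma rep_star_tau_contraction M x : `|pi (star (tau s z M)) x| <= `|x|.
Proof.
have tau_contr y : `|pi (tau s z M) y| <= `|y|.
  rewrite -ler_sqr ?nnegrE // norm_inner rep_star -repM star_tau_tau //.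
  rewrite -massE rep_scalar -[inner _ _]/(hilbert_form H _ _) sipZr.
  rewrite (CrealP (ger0_real (mass_ge0 _ _))) -[hilbert_form H y y]norm_inner.
  by rewrite -[leRHS]mul1r ler_wpM2r ?exprn_ge0 // (mass_le1 n_ge2 s_cuntz _ zP).
set y := pi _ x; have [->|y0] := eqVneq `|y| 0; first by rewrite normr_ge0.
have e : `|y| ^+ 2 = inner x (pi (tau s z M) y).
  by rewrite norm_inner {1}/y rep_star starK.
rewrite -(ler_pM2r (_ : 0 < `|y|)) ?lt0r ?y0 //= -expr2.
have := norm_inner_le x (pi (tau s z M) y).
rewrite -e ger0_norm ?exprn_ge0 // => /le_trans; apply.
by rewrite ler_wpM2l.
Qed.

Lemma norm_lambda_le1 M : `|lambda M| <= 1.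
Proof.
have := rep_star_tau_contraction M Omega2.
by rewrite rep_star_tau2 normrZ normO2 mulr1.
Qed.

Lemma rep_star_tau_pow1 M L :
  pi (star (tau s z M) ^+ L) Omega1 = mass z M ^+ L *: Omega1.
Proof.
elim: L => [|L IH]; first by rewrite rep1 scale1r.
by rewrite exprSr repM rep_star_tau1 linearZ /= IH scalerA -exprS.
Qed.

Lemma rep_star_tau_pow_contraction M L x :
  `|pi (star (tau s z M) ^+ L) x| <= `|x|.
Proof.
elim: L x => [|L IH] x; first by rewrite rep1.
by rewrite exprSr repM; apply: le_trans (IH _) (rep_star_tau_contraction _ _).
Qed.

Lemma filt_approx (e : C) : 0 < e -> exists L b,
  gp_filt s (null S2) L b /\ `|Omega1 - pi b Omega2| <= e.
Proof.
move=> e0; have e20 := divr_gt0 e0 (ltr0Sn _ 1).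
have ne : ball Omega1 (e / 2) !=set0 by exists Omega1; exact: ballxx.
have [x [/= + [a _ ax]]] := Omega2_cyclic ne (ball_open _ _).
rewrite -ax -ball_normE /ball_ /= => aO.
(* One more halving absorbs the factor 2 of [gns_snormM]. *)
have e40 := divr_gt0 e20 (ltr0Sn _ 1).
have [L [b [Fb ab]]] := gp_filt_dense n_ge2 s_cuntz (@null_linear _ _ _ S2)
  (@null_ideal _ _ _ S2) wP s_gen a e40.
exists L, b; split=> //.
rewrite -(subrK (pi a Omega2) Omega1) -addrA; apply: le_trans (ler_normD _ _) _.
rewrite [leRHS]splitr lerD ?(ltW aO) // -repB (norm_rep_vector S2.1 Omega2P).
have := gns_snormM S2.1 half_small (a - b) 1.
rewrite mulr1 snorm1 mulr1 => /le_trans; apply.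
by rewrite mulrC -ler_pdivlMr // ltW.
Qed.

(* [star (tau s z M)] multiplies [Omega1] by [mass z M] and [Omega2] by
   [lambda M], and its power [L] maps an approximant of [Omega1] to the line of
   [Omega2]; so the two factors must be close. *)
Lemma lambda_mass (e : C) : 0 < e -> exists L, forall M,
  mass z M ^+ L * `|lambda M - mass z M| <= e.
Proof.
move=> e0; have e20 := divr_gt0 e0 (ltr0Sn _ 1).
(* [L] depends on [e] alone, so that [M] may be enlarged afterwards with [L] fixed. *)
have [L [b [Fb be]]] := filt_approx e20; exists L => M.
have [c cP] := star_tau_filt z M (@null_linear _ _ _ S2)
  (@null_ideal _ _ _ S2) wP Fb.
pose T := star (tau s z M); pose p := mass z M.
have x1 : `|p ^+ L *: Omega1 - c *: Omega2| <= e / 2.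
  rewrite -rep_star_tau_pow1 -(rep_null_vector Omega2P cP) repM -linearB.
  exact: le_trans (rep_star_tau_pow_contraction _ _ _) be.
(* The vector bounded in [x1] is now hit by the operator [star tau], and in [x3] multiplied by the
   scalar [lambda M]. Both results contain the same multiple of [Omega2], which the triangle
   inequality eliminates. *)
have x2 : `|(p * p ^+ L) *: Omega1 - (c * lambda M) *: Omega2| <= e / 2.
  apply: le_trans x1.
  have := rep_star_tau_contraction M (p ^+ L *: Omega1 - c *: Omega2).
  have -> : pi (star (tau s z M)) (p ^+ L *: Omega1 - c *: Omega2) =
      (p * p ^+ L) *: Omega1 - (c * lambda M) *: Omega2.
    rewrite linearB; congr (_ - _); rewrite linearZ /=.
      by rewrite rep_star_tau1 scalerA mulrC.
    by rewrite rep_star_tau2 scalerA.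
  by [].
have x3 : `|(lambda M * p ^+ L) *: Omega1 - (c * lambda M) *: Omega2| <= e / 2.
  rewrite [c * _]mulrC -!scalerA -scalerBr normrZ; apply: le_trans x1.
  by rewrite ler_piMl // norm_lambda_le1.
have p0 : 0 <= p ^+ L by rewrite exprn_ge0 // mass_ge0.
have -> : p ^+ L * `|lambda M - p| =
    `|(lambda M * p ^+ L - p * p ^+ L) *: Omega1|.
  by rewrite -mulrBl normrZ normO1 mulr1 normrM (ger0_norm p0) mulrC.
rewrite scalerBl.
rewrite -(subrK ((c * lambda M) *: Omega2) ((lambda M * p ^+ L) *: Omega1)).
rewrite -addrA; apply: le_trans (ler_normD _ _) _; rewrite [leRHS]splitr.
by apply: lerD x3 _; rewrite distrC.
Qed.

Lemma gp_param_eq : z = w.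
Proof.
apply/funext => j; apply/eqP; rewrite -subr_eq0 -normr_eq0 -sqrf_eq0 eq_le.
rewrite exprn_ge0 // andbT; apply/ler_addgt0Pr => e e0; rewrite add0r.
have e8 : 0 < e / 8 by rewrite divr_gt0.
have [L LP] := lambda_mass e8.
(* Once [L] is fixed, [1 - p < 1 / (2 (L + 1))] keeps [p ^+ L] above 1/2, so that the bound [e / 8]
   gives [|p - lambda M| <= e / 4]. *)
have L0 : 0 < (2 * L.+1)%:R :> C by rewrite ltr0n.
have [M1 M1P] := z_full (divr_gt0 ltr01 L0).
have [M2 M2P] := z_full (divr_gt0 e0 (ltr0Sn _ 1)).
pose M := maxn j.+1 (maxn M1 M2).
have jM : (j < M)%N by rewrite leq_max ltnSn.
have {}M1P : 1 - mass z M < 1 / (2 * L.+1)%:R.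
  by apply: M1P; rewrite !leq_max leqnn !orbT.
have {}M2P : 1 - mass z M < e / 2.
  by apply: M2P; rewrite !leq_max leqnn !orbT.
set p := mass z M in M1P M2P.
have p0 : 0 <= p := mass_ge0 z M.
have p1 : p <= 1 := mass_le1 n_ge2 s_cuntz M zP.
(* Bernoulli's inequality. *)
have pL k : 1 - k%:R * (1 - p) <= p ^+ k.
  elim: k => [|k IH]; first by rewrite mul0r subr0.
  rewrite exprS; apply: le_trans (ler_wpM2l p0 IH).
  rewrite -subr_ge0 -natr1.
  have -> : p * (1 - k%:R * (1 - p)) - (1 - (k%:R + 1) * (1 - p)) =
    k%:R * (1 - p) ^+ 2 by ring.
  by rewrite mulr_ge0 ?ler0n // exprn_ge0 // subr_ge0.
have pL2 : 2^-1 <= p ^+ L.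
  apply: le_trans (pL L); rewrite lerBrDl -lerBrDr.
  have -> : 1 - 2^-1 = 2^-1 :> C by rewrite {1}[1]splitr div1r addrK.
  apply: le_trans (_ : L%:R * (1 / (2 * L.+1)%:R) <= _).
    by rewrite ler_wpM2l ?ler0n // ltW.
  rewrite mul1r natrM invfM mulrCA ler_piMr ?invr_ge0 //.
  by rewrite ler_pdivrMr ?ltr0n // mul1r ler_nat.
have close : `|p - lambda M| <= e / 4.
  rewrite distrC; apply: le_trans (_ : 2 * (p ^+ L * `|lambda M - p|) <= _).
    rewrite mulrA ler_peMl // -ler_pdivrMl //; first by rewrite mulr1.
  apply: le_trans (_ : 2 * (e / 8) <= _); first by rewrite ler_pM2l // LP.
  by rewrite le_eqVlt; apply/orP; left; apply/eqP; field.
(* The first two terms are twice a real part, at most [e / 2]. The last one is at most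
   [1 - p < e / 2], because [mass w M <= 1]. *)
have sumsq : \sum_(i < M) `|z i - w i| ^+ 2 =
    (p - lambda M) + (p - lambda M)^* + (mass w M - p).
  have -> : (p - lambda M)^* = p - \sum_(i < M) (w i)^* * z i.
    rewrite rmorphB /= (CrealP (ger0_real p0)) rmorph_sum; congr (_ - _).
    by apply: eq_bigr => i _; rewrite rmorphM /= conjCK mulrC.
  rewrite /p massE /mass -!sumrB -!big_split /= ; apply: eq_bigr => i _.
  by rewrite !normCK rmorphB /=; ring.
apply: le_trans (_ : \sum_(i < M) `|z i - w i| ^+ 2 <= _).
  rewrite (bigD1 (Ordinal jM)) //= lerDl.
  by apply: sumr_ge0 => i _; rewrite exprn_ge0.
rewrite sumsq [leRHS]splitr; apply: lerD.
  set x := p - lambda M.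
  have -> : x + x^* = 'Re x *+ 2 by rewrite ReE -mulr_natr divfK // pnatr_eq0.
  apply: le_trans (_ : (e / 4) *+ 2 <= _).
    rewrite lerMn2r /=; apply: le_trans close.
    by rewrite (le_trans (real_ler_norm (Creal_Re _))) // leif_normC_Re_Creal.
  by rewrite le_eqVlt; apply/orP; left; apply/eqP; field.
apply: le_trans (ltW M2P); rewrite lerD2r; exact: (mass_le1 n_ge2 s_cuntz M wP).
Qed.

End Inequivalence.

(** * Geometric progression states *)

Lemma unitarily_equivalent_refl (C : numClosedFieldType) (A : cstarAlgType C)
    (H : hilbertType C) (pi : star_representation A H) :
  unitarily_equivalent pi pi.
Proof. by exists (idfun : {linear H -> H}); split=> //; exists idfun. Qed.

Section GeometricStates.
Variables (C : numClosedFieldType) (A : cstarAlgType C) (n : nat).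
Variables (n_ge2 : (2 <= n)%N) (s : n.-tuple A) (s_cuntz : cuntz_family s).
Local Notation sn := (s`_n.-1).

Let d_gt0 : (0 < n.-1)%N. Proof. by case: n n_ge2 => [|[]]. Qed.

Lemma ell2_full_mass (z : nat -> C) : ell2_unit z -> full_mass z.
Proof.
move=> /cvgn_lt z1 e /z1[M0 MP]; exists M0 => M /MP.
rewrite distrC /series /= big_mkord -/(mass z M); apply: le_lt_trans.
by rewrite real_ler_norm // realB ?real1 // ger0_real // mass_ge0.
Qed.

(** Bessel's inequality bounds the defect of the word [j] by [1 - mass z M] for every [M > j], and
    this tends to 0. *)
Lemma gp_infty_word_null (z : nat -> C) (omega : {scalar A}) (S : state omega) :
  full_mass z -> gp_state_infty s z omega -> word_null s S z.
Proof.
move=> z1 [_ omegaE] j.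
have tE i : omega (gp_word s i) = (z i)^*.
  by rewrite /gp_word omegaE ?ltn_pmod // mulnC -divn_eq.
apply/le_anti/andP; split; last exact: sip_ge0.
apply/ler_addgt0Pr => e /z1[M0 M0P]; rewrite add0r.
have jM : (j < maxn j.+1 M0)%N by rewrite leq_max ltnSn.
have := orthonormal_null_bound S (u := gp_word s)
  (fun i i' _ _ => gp_word_ortho n_ge2 s_cuntz i i') jM.
rewrite tE conjCK => /le_trans; apply; apply/ltW.
apply: le_lt_trans (M0P _ (leq_maxr _ _)).
by rewrite lerD2l lerN2; apply: ler_sum => i _; rewrite tE norm_conjC.
Qed.

(** The first [D] words and [s_n^k] are orthonormal and [y] is a unit vector, so Bessel's inequality
    leaves no defect on this finite family. The remaining words are reached by multiplying with
    powers of [s_n^k]. *)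
Lemma gp_word_null k (y : (n.-1 * k).+1.-tuple C) (omega : {scalar A})
    (S : state omega) : (0 < k)%N ->
  unit_vector y -> gp_state s k y omega -> word_null s S (geometric_seq y).
Proof.
move=> k0 y1 [_ omegaE omega_pow].
set D := (n.-1 * k)%N in y y1 omegaE omega_pow *.
have D0 : (0 < D)%N by rewrite muln_gt0 d_gt0.
pose u j := if (j < D)%N then gp_word s j else sn ^+ k.
have uE j : (j < D.+1)%N -> omega (u j) = (y`_j)^*.
  rewrite ltnS leq_eqVlt /u => /orP[/eqP ->|jD]; first by rewrite ltnn omega_pow.
  rewrite jD /gp_word omegaE ?ltn_pmod //; first by rewrite mulnC -divn_eq.
  by rewrite ltn_divLR // mulnC.
have u_ortho i j : (i < D.+1)%N -> (j < D.+1)%N ->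
    star (u i) * u j = (i == j)%:R.
  rewrite !ltnS (leq_eqVlt i) (leq_eqVlt j) /u.
  move=> /orP[/eqP ->|iD] /orP[/eqP ->|jD].
  - by rewrite ltnn eqxx starX_isometry.
  - rewrite ltnn jD (gtn_eqF jD) -(starK (gp_word s j)) -starM.
    by rewrite (star_gp_word_pow n_ge2 s_cuntz) // star0.
  - by rewrite ltnn iD (ltn_eqF iD) (star_gp_word_pow n_ge2 s_cuntz).
  - by rewrite iD jD gp_word_ortho.
have u_null j : (j < D.+1)%N -> null S (star (u j) - y`_j *: 1).
  move=> jD; have := orthonormal_null_bound S u_ortho jD.
  rewrite uE // conjCK (eq_bigr (fun i : 'I_D.+1 => `|y`_i| ^+ 2)); last first.
    by move=> i _; rewrite uE // norm_conjC.
  rewrite y1 subrr => le0.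
  by apply/le_anti/andP; split; [exact: le0 | exact: sip_ge0].
(* The word [D + j] is [s_n^k] times the word [j], so each block of [D] words gains one factor
   [y_D]. *)
have block q i : (i < D)%N ->
    null S (star (gp_word s (D * q + i)) - (y`_D ^+ q * y`_i) *: 1).
  move=> iD; elim: q => [|q IH].
    by rewrite muln0 mul1r; have := u_null i (ltnW iD); rewrite /u iD.
  have pow_null : null S (star (sn ^+ k) - y`_D *: 1).
    by have := u_null D (ltnSn D); rewrite /u ltnn.
  rewrite mulnS -addnA gp_wordD // starM.
  set x := star (gp_word s _) in IH *.
  have -> : x * star (sn ^+ k) - (y`_D ^+ q.+1 * y`_i) *: 1 =
      y`_D *: (x - (y`_D ^+ q * y`_i) *: 1) + x * (star (sn ^+ k) - y`_D *: 1).
    rewrite mulrBr -scalerAr mulr1 scalerBr scalerA exprS -mulrA.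
    by rewrite [RHS]addrC addrA subrK.
  by apply: null_linear => //; exact: null_ideal.
move=> j; rewrite (divn_eq j D) mulnC.
have jD : (j %% D < D)%N by rewrite ltn_pmod.
by rewrite (geometric_seqE y _ jD); exact: block.
Qed.

(** A last coordinate of modulus 1 leaves nothing for the others. This rules out [|y_n| = 1] for
    Cuntz states, as the zero sequence has no mass. *)
Lemma geometric_seq_eq0 D (y : D.+1.-tuple C) : (0 < D)%N ->
  unit_vector y -> 1 <= `|y`_D| -> geometric_seq y = fun=> 0.
Proof.
move=> D0 y1 yD.
have y0 i : (i < D)%N -> y`_i = 0.
  move=> iD; move: y1; rewrite /unit_vector big_ord_recr /= => y1.
  have : \sum_(i < D) `|y`_i| ^+ 2 <= 0.
    rewrite -(lerD2r (`|y`_D| ^+ 2)) y1 add0r -(expr1n _ 2).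
    by rewrite ler_sqr ?nnegrE.
  rewrite (bigD1 (Ordinal iD)) //= => yi.
  apply/eqP; rewrite -normr_eq0 -sqrf_eq0 eq_le exprn_ge0 // andbT.
  apply: le_trans yi; rewrite lerDl.
  by apply: sumr_ge0 => j _; rewrite exprn_ge0.
apply/funext => j; rewrite (divn_eq j D) mulnC.
have jD : (j %% D < D)%N by rewrite ltn_pmod.
by rewrite (geometric_seqE y _ jD) (y0 _ jD) mulr0.
Qed.

Hypotheses (half_small : halving C) (C_complete : cauchy_complete C).
Hypothesis s_gen : cstar_generated s.

(** Allowing [k = 1] covers Cuntz states and geometric progression states of finite order at
    once. *)
Lemma gp_equivalence (z : nat -> C) (omega omega' : {scalar A}) k m
    (y : m.-tuple C) :
  ell2_unit z -> gp_state_infty s z omega ->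
  (0 < k)%N -> m = (n.-1 * k).+1 -> unit_vector y -> gp_state s k y omega' ->
  (equivalent_states omega omega' <->
     `|y`_m.-1| < 1 /\ z = geometric_seq y) /\
  (equivalent_states omega omega' -> omega =1 omega').
Proof.
move=> z_unit omegaP k0 mE; rewrite {m}mE in y *; move=> y1 omega'P.
have z1 := ell2_full_mass z_unit.
have [S _] := omegaP; have [S' _ _] := omega'P.
have zP := gp_infty_word_null S z1 omegaP.
have yP := gp_word_null S' k0 y1 omega'P.
have eqz : equivalent_states omega omega' -> z = geometric_seq y.
  move=> [H1 [H2 [pi1 [pi2 [Omega1 [Omega2 [[G1 _] [G2 G2d]]]]]]]].
  move=> [U [_ Uinner Upi]].
  (* The intertwiner [U] carries the first cyclic vector into the second space, where both
     parameters are compared. *)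
  apply: (gp_param_eq half_small n_ge2 s_cuntz s_gen (pi := pi2)
    (Omega1 := U Omega1) _ G2 G2d zP yP z1) => a.
  by rewrite -Upi Uinner.
have eqomega : z = geometric_seq y -> omega =1 omega'.
  move=> zy; apply: (state_unique half_small n_ge2 s_cuntz s_gen zP _ z1).
  by rewrite zy.
split; last by move/eqz/eqomega.
split=> [/eqz zy | [_ /eqomega eqo]].
  split=> //=; rewrite real_ltNge ?real1 ?normr_real //; apply/negP => yD.
  have [M /(_ M (leqnn M))] := z1 1 ltr01.
  rewrite zy (geometric_seq_eq0 _ y1 yD) ?muln_gt0 ?d_gt0 // /mass big1.
    by rewrite subr0 ltxx.
  by move=> i _; rewrite normr0 expr0n.
(* Conversely the states coincide, and a single GNS triple serves for both. *)
have [H [pi [Omega G]]] := gns_exists half_small C_complete S.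
exists H, H, pi, pi, Omega, Omega; split=> //.
  by case: G => G Gd; split=> // a; rewrite -eqo.
exact: unitarily_equivalent_refl.
Qed.

End GeometricStates.

(** For order 1 the words are the first [n - 1] generators, and the closing power [s_n^1] is the
    last one. *)
Lemma cuntz_gp_state (C : numClosedFieldType) (A : cstarAlgType C) n
    (s : n.-tuple A) (y : n.-tuple C) (omega : {scalar A}) :
  (0 < n)%N -> cuntz_state s y omega -> gp_state s 1 y omega.
Proof.
move=> n0 [S omegaE].
have E i : (i < n)%N -> omega s`_i = (y`_i)^*.
  by move=> i_n; rewrite (omegaE (Ordinal i_n)).
split=> // [r i|]; last by rewrite expr1 E // prednK.
rewrite ltnS leqn0 => /eqP -> id.
by rewrite mul1r muln0 E // (ltn_trans id) // prednK.
Qed.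

Theorem theorem1p9 (R : realType) (n : nat) (n_ge2 : (2 <= n)%N)
    (On : cstarAlgType R[i]) (s : n.-tuple On) (On_cuntz : cuntz_algebra s)
    (z : nat -> R[i]) (z_unit : ell2_unit z)
    (omega'_z : {scalar On}) (omega'_zP : gp_state_infty s z omega'_z) :
  (forall (y : n.-tuple R[i]) (omega_y : {scalar On}),
      unit_vector y -> cuntz_state s y omega_y ->
      (equivalent_states omega'_z omega_y <->
         `|y`_n.-1| < 1 /\ z = geometric_seq y) /\
      (equivalent_states omega'_z omega_y -> omega'_z =1 omega_y)) /\
  (forall (k m : nat) (y : m.-tuple R[i]) (omega'_y : {scalar On}),
      (2 <= k)%N -> m = (n.-1 * k).+1 ->
      unit_vector y -> `|y`_m.-1| < 1 -> gp_state s k y omega'_y ->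
      (equivalent_states omega'_z omega'_y <-> z = geometric_seq y) /\
      (equivalent_states omega'_z omega'_y -> omega'_z =1 omega'_y)).
Proof.
have [s_cuntz s_gen _] := On_cuntz.
have gp := @gp_equivalence _ _ n n_ge2 s s_cuntz (@complex_halving R)
  (@complex_complete R) s_gen z omega'_z.
have n0 : (0 < n)%N by exact: ltnW.
split=> [y omega_y y1 omega_yP | k m y omega'_y k2 mE y1 yD omega'_yP].
  have nE : n = (n.-1 * 1).+1 by rewrite muln1 prednK.
  apply: (gp _ _ _ y z_unit omega'_zP _ nE y1) => //.
  exact: cuntz_gp_state.
have [equiv eqo] := gp _ _ _ y z_unit omega'_zP (ltnW k2) mE y1 omega'_yP.
by split=> //; rewrite equiv; split=> [[]|].
Qed.
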